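(* Let $(M,\mathfrak{g})$ be an ODD Riemannian manifold. There exists a unique algebroid connection $\nabla$ in $TM$ that is both an ODD metric connection with respect to $\mathfrak{g}$ and symmetric.
   Context: ODD Riemannian metric (inductive definition). Let $M$ be a real-analytic manifold of dimension $n$. An ODD Riemannian metric $\mathfrak{g}$ on $M$ is a real-analytic section of $\mathrm{Sym}^2(T^*M)$ such that, for the induced symmetric bilinear forms $\mathfrak{g}_p\colon T_pM\times T_pM\to\mathbb{R}$: (1) $\mathfrak{g}_p$ is positive semidefinite for all $p\in M$; (2) there is a finite collection $N_1,\dots,N_m$ of closed analytic submanifolds of $M$ of strictly smaller dimension such that $\mathfrak{g}_p$ is nondegenerate for $p\in M\setminus\bigcup_j N_j$; (3) for each $j$, the symmetric form $\mathfrak{g}^{N_j}$ induced by $\mathfrak{g}$ on $TN_j$ is again an ODD Riemannian metric on $N_j$; (4) the collection $N_1,\dots,N_m$ is simple normal crossing, i.e. around every point of $M$ there is a chart $(x^i)_{i=1,\dots,n}$ in which every $N_j$ is given by the vanishing of some of the coordinates. The pair $(M,\mathfrak{g})$ is an ODD Riemannian manifold. Write $\langle X,Y\rangle=\mathfrak{g}(X,Y)$, extended bilinearly to algebroid vector fields. Algebroid functions and sections. For a (connected) open set $U\subseteq M$, $\mathcal{M}(U)$, the real-meromorphic functions, is the field of fractions of the domain $C^\omega(U)$ of real-analytic functions on $U$, and $\mathcal{A}(U)=\mathcal{M}(U)^{\mathrm{alg}}$, the algebroid functions, is the algebraic closure of $\mathcal{M}(U)$. $\mathcal{M}(TM)$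 and $\mathcal{A}(TM)$ denote the meromorphic, resp. algebroid, vector fields, i.e. those whose coefficients in real-analytic local frames are meromorphic, resp. algebroid, functions. Algebroid connection. An algebroid connection in $TM$ is a map $\nabla\colon\mathcal{A}(TM)\times\mathcal{A}(TM)\to\mathcal{A}(TM)$, $(X,Y)\mapsto\nabla_XY$, such that $\nabla_XY$ is $\mathcal{A}(M)$-linear in $X$ and $\mathbb{R}$-linear in $Y$, and $\nabla_X(fY)=f\nabla_XY+(Xf)Y$ for $f\in\mathcal{A}(M)$. It is an ODD metric connection if $X\langle Y,Z\rangle=\langle\nabla_XY,Z\rangle+\langle Y,\nabla_XZ\rangle$ for all $X,Y,Z\in\mathcal{M}(TM)$. It is symmetric if the torsion $\tau(X,Y)=\nabla_XY-\nabla_YX-[X,Y]$ vanishes identically for all $X,Y\in\mathcal{A}(TM)$. *)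

(* Defs.v *)
From HB Require Import structures.
From mathcomp Require Import all_boot all_order all_algebra.
From mathcomp Require Import all_classical all_reals all_analysis.

Set Implicit Arguments.
Unset Strict Implicit.
Unset Printing Implicit Defensive.

Import Order.TTheory GRing.Theory Num.Theory numFieldNormedType.Exports.

Local Open Scope classical_set_scope.
Local Open Scope ring_scope.

Section Analytic.
Context {R : realType} {n : nat}.

Definition monomial (x : 'rV[R]_n) (alpha : 'I_n -> nat) : R :=
  \prod_(i < n) x 0 i ^+ alpha i.

(* Sum of the multi-indexed family [u] over the box {0, ..., N-1}^n. *)
Definition box_sum (u : ('I_n -> nat) -> R) : R^nat :=
  fun N => \sum_(alpha : {ffun 'I_n -> 'I_N}) u (fun i => alpha i : nat).

Definition abs_sums_to (u : ('I_n -> nat) -> R) (l : R) : Prop :=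
  cvgn (box_sum (fun alpha => `|u alpha|)) /\ box_sum u @ \oo --> l.

(* [f] is the sum of an absolutely convergent power series in a polydisc
   around [a]. *)
Definition analytic_at (f : 'rV[R]_n -> R) (a : 'rV[R]_n) : Prop :=
  exists (c : ('I_n -> nat) -> R) (r : R), 0 < r /\
    forall x : 'rV[R]_n, (forall i, `|x 0 i - a 0 i| < r) ->
      abs_sums_to (fun alpha => c alpha * monomial (x - a) alpha) (f x).

(* Only used for open [A], where it does not depend on the values outside. *)
Definition analytic_on (A : set 'rV[R]_n) (f : 'rV[R]_n -> R) : Prop :=
  forall a, A a -> analytic_at f a.

Definition mx_analytic_on p q (A : set 'rV[R]_n) (f : 'rV[R]_n -> 'M[R]_(p, q))
    : Prop :=
  forall i j, analytic_on A (fun x => f x i j).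

End Analytic.

(* [chart_map] matters only on [chart_dom], [chart_inv] only on its image. *)
Record chart (R : realType) (n : nat) (T : topologicalType) := Chart {
  chart_dom : set T;
  chart_map :> T -> 'rV[R]_n;
  chart_inv : 'rV[R]_n -> T }.

Section Charts.
Context {R : realType} {n : nat} {T : topologicalType}.
Implicit Types c : chart R n T.

Definition chart_img c : set 'rV[R]_n := c @` chart_dom c.

Definition is_chart c : Prop :=
  [/\ open (chart_dom c), open (chart_img c),
      {in chart_dom c, cancel c (chart_inv c)},
      {within chart_dom c, continuous c} &
      {within chart_img c, continuous (chart_inv c)}].

Definition transition_analytic c c' : Prop :=
  mx_analytic_on (c @` (chart_dom c `&` chart_dom c')) (c' \o chart_inv c).

Definition chart_compatible c c' : Prop :=
  transition_analytic c c' /\ transition_analytic c' c.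

End Charts.

Record manifold (R : realType) (n : nat) := Manifold {
  manifold_sort :> topologicalType;
  atlas : set (chart R n manifold_sort);
  manifold_hausdorff : hausdorff_space manifold_sort;
  manifold_second_countable : @second_countable manifold_sort;
  atlas_chart : forall c, atlas c -> is_chart c;
  atlas_cover : forall p, exists c, atlas c /\ chart_dom c p;
  atlas_compatible : forall c c', atlas c -> atlas c' -> chart_compatible c c';
  atlas_maximal : forall c, is_chart c ->
    (forall c', atlas c' -> chart_compatible c c') -> atlas c }.

Definition chart_at (R : realType) (n : nat) (M : manifold R n) (p : M)
    : chart R n M :=
  sval (cid (atlas_cover p)).

(* A tensor field is given by its components in all charts of the atlas,
   subject to the usual transformation law.  Vectors are rows, covectors are
   columns and ['J] is the Jacobian acting on row vectors from the right, so
   that [v *m 'J f a] is the derivative of [f] at [a] along [v].  Components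
   of a field at [(p, c)] are meaningless unless [c] is a chart at [p]. *)

Section Fields.
Context {R : realType} {n : nat} (M : manifold R n).

Definition function := M -> R.
Definition vector_field := M -> chart R n M -> 'rV[R]_n.
Definition one_form := M -> chart R n M -> 'cV[R]_n.
Definition bilinear_field := M -> chart R n M -> 'M[R]_n.

Definition jac (c c' : chart R n M) (p : M) : 'M[R]_n :=
  'J (c' \o chart_inv c) (c p).

Definition charts_at (p : M) : set (chart R n M) :=
  [set c | atlas c /\ chart_dom c p].

Definition analytic_function (f : function) : Prop :=
  forall c, atlas c -> analytic_on (chart_img c) (f \o chart_inv c).

Definition analytic_components a b (F : M -> chart R n M -> 'M[R]_(a, b))
    : Prop :=
  forall c, atlas c ->
    mx_analytic_on (chart_img c) (fun x => F (chart_inv c x) c).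

Definition analytic_vector_field (X : vector_field) : Prop :=
  (forall p c c', charts_at p c -> charts_at p c' ->
     X p c' = X p c *m jac c c' p) /\ analytic_components X.

Definition analytic_one_form (theta : one_form) : Prop :=
  (forall p c c', charts_at p c -> charts_at p c' ->
     theta p c = jac c c' p *m theta p c') /\ analytic_components theta.

Definition analytic_symmetric_form (g : bilinear_field) : Prop :=
  [/\ forall p c c', charts_at p c -> charts_at p c' ->
        g p c = jac c c' p *m g p c' *m (jac c c' p)^T,
      forall p c, charts_at p c -> (g p c)^T = g p c &
      analytic_components g].

Definition positive_semidefinite_at (g : bilinear_field) (p : M) : Prop :=
  forall c, charts_at p c ->
    forall v : 'rV[R]_n, 0 <= (v *m g p c *m v^T) 0 0.

Definition nondegenerate_at (g : bilinear_field) (p : M) : Prop :=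
  forall c, charts_at p c -> forall v : 'rV[R]_n,
    (forall w : 'rV[R]_n, (v *m g p c *m w^T) 0 0 = 0) -> v = 0.

Definition pairing (theta : one_form) (X : vector_field) : function :=
  fun p => (X p (chart_at p) *m theta p (chart_at p)) 0 0.

Definition metric_pairing (g : bilinear_field) (X Y : vector_field)
    : function :=
  fun p => (X p (chart_at p) *m g p (chart_at p) *m (Y p (chart_at p))^T) 0 0.

Definition dform (f : function) : one_form :=
  fun p c => \col_i 'D_(delta_mx 0 i) (f \o chart_inv c) (c p).

Definition lie_bracket (X Y : vector_field) : vector_field :=
  fun p c => 'D_(X p c) (fun x => Y (chart_inv c x) c) (c p)
           - 'D_(Y p c) (fun x => X (chart_inv c x) c) (c p).

End Fields.

Section Submanifolds.
Context {R : realType} {d n : nat} {N : manifold R d} {M : manifold R n}.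
Implicit Type phi : N -> M.

Definition map_jac phi (c : chart R d N) (c' : chart R n M) (p : N)
    : 'M[R]_(d, n) :=
  'J (c' \o phi \o chart_inv c) (c p).

Definition analytic_map phi : Prop :=
  continuous phi /\
  forall c c', atlas c -> atlas c' ->
    mx_analytic_on (c @` (chart_dom c `&` phi @^-1` chart_dom c'))
                   (c' \o phi \o chart_inv c).

(* Closed analytic submanifolds are the images of these maps: analytic
   injective immersions that are homeomorphisms onto a closed image. *)
Definition closed_embedding phi : Prop :=
  [/\ analytic_map phi, injective phi,
      forall U : set N, open U -> exists2 V : set M, open V & U = phi @^-1` V,
      closed (range phi) &
      forall p c c', charts_at p c -> charts_at (phi p) c' ->
        row_free (map_jac phi c c' p)].

Definition pullback phi (g : bilinear_field M) : bilinear_field N :=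
  fun p c => let J := map_jac phi c (chart_at (phi p)) p in
             J *m g (phi p) (chart_at (phi p)) *m J^T.

End Submanifolds.

(* Around every point there is a chart in which every [phi j] either does not
   occur or is the vanishing locus of [n - d j] of the coordinates. *)
Definition simple_normal_crossing (R : realType) (n : nat) (M : manifold R n)
    (m : nat) (d : 'I_m -> nat) (N : forall j, manifold R (d j))
    (phi : forall j, N j -> M) : Prop :=
  forall p : M, exists c : chart R n M, charts_at p c /\
    forall j : 'I_m,
      range (phi j) `&` chart_dom c = set0 \/
      exists S : {set 'I_n}, (#|S| + d j = n)%N /\
        forall q, chart_dom c q ->
          (range (phi j) q <-> forall i, i \in S -> c q 0 i = 0).

Inductive ODD_metric (R : realType) :
    forall (n : nat) (M : manifold R n), bilinear_field M -> Prop :=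
  ODD_metric_intro (n : nat) (M : manifold R n) (g : bilinear_field M)
    (m : nat) (d : 'I_m -> nat) (N : forall j, manifold R (d j))
    (phi : forall j, N j -> M) :
    analytic_symmetric_form g ->
    (forall p, positive_semidefinite_at g p) ->
    (forall j, (d j < n)%N) ->
    (forall j, closed_embedding (phi j)) ->
    (forall p, (forall j, ~ range (phi j) p) -> nondegenerate_at g p) ->
    (forall j, ODD_metric (pullback (phi j) g)) ->
    simple_normal_crossing phi ->
    ODD_metric g.

Section Algebroid.
Context {R : realType} {n : nat} (M : manifold R n).
Context (K : closedFieldType) (iota : function M -> K).

(* Field of fractions of the (embedded) ring of analytic functions. *)
Definition meromorphic : set K :=
  [set x | exists f h : function M,
     [/\ analytic_function f, analytic_function h, h <> cst 0 &
         x = iota f / iota h]].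

(* The algebraically closed field [K], with the embedding [iota] of the ring
   of analytic functions on M, is an algebraic closure of the field of
   fractions of that ring.  [iota] is irrelevant on non-analytic functions. *)
Definition algebroid_functions : Prop :=
  [/\ forall f h, analytic_function f -> analytic_function h ->
        iota (f \+ h) = iota f + iota h /\ iota (f \* h) = iota f * iota h,
      iota (cst 1) = 1,
      forall f, analytic_function f -> iota f = 0 -> f = cst 0 &
      forall x : K, exists p : {poly K},
        [/\ p != 0, forall i, meromorphic p`_i & root p x]].

(* The space of algebroid vector fields is the extension of scalars to [K] of
   the module of analytic vector fields over the analytic functions: finite
   sums of [a_i X_i] with [a_i] in [K] and [X_i] analytic.  Such a sum is
   identified with its coefficients against analytic one-forms, i.e. with
   theta |-> sum a_i theta(X_i); the value on a non-analytic one-form is set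
   to 0 by convention. *)
Definition Kfield := one_form M -> K^o.
HB.instance Definition _ := GRing.Lmodule.on Kfield.

Definition of_vector_field (X : vector_field M) : Kfield :=
  fun theta => if `[< analytic_one_form theta >] then iota (pairing theta X)
               else 0.

Definition combination m (a : 'I_m -> K) (X : 'I_m -> vector_field M)
    : Kfield :=
  \sum_(i < m) a i *: of_vector_field (X i).

Definition represents (v : Kfield) m (a : 'I_m -> K)
    (X : 'I_m -> vector_field M) : Prop :=
  (forall i, analytic_vector_field (X i)) /\ v = combination a X.

Definition algebroid_vf : set Kfield :=
  [set v | exists m (a : 'I_m -> K) X, represents v a X].

Definition meromorphic_vf : set Kfield :=
  [set v | exists m (a : 'I_m -> K) X,
     (forall i, meromorphic (a i)) /\ represents v a X].

(* [act], [inner] and [bracket] select a value that exists and is unique when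
   the vector fields are algebroid and, for [inner], [g] is analytic. *)

(* Action on algebroid functions: the unique derivation of [K] extending
   f |-> v(df) on analytic functions. *)
Definition derivation_along (v : Kfield) : set (K -> K) :=
  [set D | [/\ forall x y, D (x + y) = D x + D y,
               forall x y, D (x * y) = D x * y + x * D y &
               forall f, analytic_function f -> D (iota f) = v (dform f)]].

Definition act (v : Kfield) : K -> K := xget (fun=> 0) (derivation_along v).

Definition inner (g : bilinear_field M) (v w : Kfield) : K :=
  xget 0 [set x | exists m (a : 'I_m -> K) X m' (b : 'I_m' -> K) Y,
    [/\ represents v a X, represents w b Y &
        x = \sum_i \sum_j a i * b j * iota (metric_pairing g (X i) (Y j))]].

(* Extension of the Lie bracket by
   [aX, bY] = a X(b) Y - b Y(a) X + a b [X, Y]. *)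
Definition bracket (v w : Kfield) : Kfield :=
  xget 0 [set u | exists m (a : 'I_m -> K) X m' (b : 'I_m' -> K) Y,
    [/\ represents v a X, represents w b Y &
        u = \sum_i \sum_j
              ((a i * act (of_vector_field (X i)) (b j))
                 *: of_vector_field (Y j)
             - (b j * act (of_vector_field (Y j)) (a i))
                 *: of_vector_field (X i)
             + (a i * b j) *: of_vector_field (lie_bracket (X i) (Y j)))]].

(* A connection is a map on pairs of elements of [algebroid_vf]; the values
   of [nabla] elsewhere are irrelevant. *)

Definition algebroid_connection (nabla : Kfield -> Kfield -> Kfield) : Prop :=
  [/\ forall X Y, algebroid_vf X -> algebroid_vf Y ->
        algebroid_vf (nabla X Y),
      forall (f : K) X X' Y,
        algebroid_vf X -> algebroid_vf X' -> algebroid_vf Y ->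
        nabla (f *: X + X') Y = f *: nabla X Y + nabla X' Y,
      forall (r : R) X Y Y',
        algebroid_vf X -> algebroid_vf Y -> algebroid_vf Y' ->
        nabla X (iota (cst r) *: Y + Y')
          = iota (cst r) *: nabla X Y + nabla X Y' &
      forall (f : K) X Y, algebroid_vf X -> algebroid_vf Y ->
        nabla X (f *: Y) = f *: nabla X Y + act X f *: Y].

Definition ODD_metric_connection (g : bilinear_field M)
    (nabla : Kfield -> Kfield -> Kfield) : Prop :=
  forall X Y Z, meromorphic_vf X -> meromorphic_vf Y -> meromorphic_vf Z ->
    act X (inner g Y Z) = inner g (nabla X Y) Z + inner g Y (nabla X Z).

Definition torsion (nabla : Kfield -> Kfield -> Kfield) (X Y : Kfield)
    : Kfield :=
  nabla X Y - nabla Y X - bracket X Y.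

Definition symmetric_connection (nabla : Kfield -> Kfield -> Kfield) : Prop :=
  forall X Y, algebroid_vf X -> algebroid_vf Y -> torsion nabla X Y = 0.

End Algebroid.

(* Main.v *)
Require Import Defs.
From HB Require Import structures.
From mathcomp Require Import all_boot all_order all_algebra.
From mathcomp Require Import all_classical all_reals all_analysis.
From mathcomp Require Import perm separable ring lra.

Set Implicit Arguments.
Unset Strict Implicit.
Unset Printing Implicit Defensive.

Import Order.TTheory GRing.Theory Num.Theory numFieldNormedType.Exports.

Local Open Scope classical_set_scope.
Local Open Scope ring_scope.

(** Analytic vector fields and one-forms may be scarce on [M], so the proof only
uses those that exist.  Let [V] be the space of algebroid vector fields, which
are by definition functionals on the analytic one-forms.

[V] is finite dimensional over [K]: a family of fields [e i] that is independent
against forms [theta j] has an invertible matrix of contractions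
[theta_j(e_i)], whose rank at a point is at most [n]; a maximal such family
spans [V] by the vanishing of bordered determinants ([exists_basis]).  The
metric is nondegenerate on [V] ([gram_det_neq0]): an analytic function that does
not vanish identically is nonzero at some point off the divisors [N_j]
([ODD_metric_nondegenerate_point]), where the [e i] are linearly independent and
[g] is positive definite, so the Gram determinant is nonzero there.

The operations on [V] exist.  An algebroid field acts on analytic functions as a
derivation, which extends to quotients by the quotient rule and from there,
uniquely, to the algebraic extension [K] of characteristic zero
([extend_derivation], by primitive elements).  The bracket is independent of the
chosen representations because [Y(theta(X)) = (L_Y theta)(X) + theta([Y, X])],
with [L_Y theta] the Lie derivative of the form ([pairing_lie_derivative],
[bracket_valueE]).  Both rest on the fact that the Lie bracket and the Lie
derivative of analytic tensors are again analytic tensors; this is proved in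
charts, from absolutely convergent power series, through the chain rule and the
symmetry of second derivatives.

What remains is the classical argument.  The Koszul formula determines
[nabla X Y] from its inner products, which gives uniqueness
([levi_civita_unique]); conversely the Koszul expression is linear in its third
argument, hence represented by an element of [V], and its behaviour in the first
two arguments is that of a symmetric metric connection
([levi_civita_exists]). *)

(** * Absolutely convergent multi-indexed sums *)

Section BoxSums.
Context {R : realType} {n : nat}.
Implicit Types (u v : ('I_n -> nat) -> R) (alpha beta : 'I_n -> nat).

(** Exponents are listed without repetition, so that partial sums over
different finite sets of exponents can be compared by inclusion of lists. *)
Definition box (N : nat) : seq ('I_n -> nat) :=
  [seq (fun i => nat_of_ord (a i)) | a : {ffun 'I_n -> 'I_N}].

Lemma box_sumE u N : box_sum u N = \sum_(alpha <- box N) u alpha.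
Proof. by rewrite /box_sum /box big_image. Qed.

Lemma box_uniq N : uniq (box N).
Proof.
rewrite map_inj_uniq ?enum_uniq// => a b eq_ab.
by apply/ffunP => i; apply: val_inj; exact: (congr1 (fun f => f i) eq_ab).
Qed.

Lemma mem_box N alpha : (alpha \in box N) <-> (forall i, (alpha i < N)%N).
Proof.
split=> [/mapP[a _ ->] i|lt_alpha]; first exact: ltn_ord.
apply/mapP; exists [ffun i => Ordinal (lt_alpha i)]; first by rewrite mem_enum.
by apply/funext => i; rewrite ffunE.
Qed.

Lemma sub_box N M : (N <= M)%N -> {subset box N <= box M}.
Proof. by move=> le_NM a /mem_box lt_a; apply/mem_box => i;
  exact: leq_trans le_NM. Qed.

Lemma sum_sub_uniq (T : eqType) (F : T -> R) (s1 s2 : seq T) :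
  uniq s1 -> uniq s2 -> {subset s1 <= s2} ->
  \sum_(x <- s2) F x
    = \sum_(x <- s1) F x + \sum_(x <- s2 | x \notin s1) F x.
Proof.
move=> uniq1 uniq2 sub12.
rewrite (bigID (mem s1))/=; congr (_ + _); rewrite -big_filter.
apply: perm_big; apply: uniq_perm; rewrite ?filter_uniq// => x.
by rewrite mem_filter andb_idr//; exact: sub12.
Qed.

(** Both differences are sums over the indices missing from the smaller list.
*)
Lemma sum_between (T : eqType) (F : T -> R) (s1 s s2 : seq T) :
  uniq s1 -> uniq s -> uniq s2 -> {subset s1 <= s} -> {subset s <= s2} ->
  `|\sum_(x <- s) F x - \sum_(x <- s1) F x|
    <= \sum_(x <- s2) `|F x| - \sum_(x <- s1) `|F x|.
Proof.
move=> uniq1 uniq_s uniq2 sub1 sub2.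
rewrite (sum_sub_uniq F uniq1 uniq_s sub1) addrAC subrr add0r.
rewrite (sum_sub_uniq (fun a => `|F a|) uniq_s uniq2 sub2).
rewrite (sum_sub_uniq (fun a => `|F a|) uniq1 uniq_s sub1).
rewrite [leRHS]addrAC [X in X + _]addrAC subrr add0r.
by rewrite (le_trans (ler_norm_sum _ _ _))// lerDl sumr_ge0.
Qed.

(** Absolute convergence makes a sum insensitive to the shape of the exhausting
finite sets: it suffices that they are squeezed between members of [e]. *)
Lemma cvg_sum_between (T : eqType) (F : T -> R) (e : nat -> seq T) (l : R)
    (w : nat -> R) (b : nat -> nat) :
  (forall N, uniq (e N)) ->
  (forall N M, (N <= M)%N -> {subset e N <= e M}) ->
  cvgn (fun N => \sum_(x <- e N) `|F x|) ->
  \sum_(x <- e N) F x @[N --> \oo] --> l ->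
  b @ \oo --> \oo ->
  (forall N, exists M (s : seq T), [/\ uniq s, {subset e (b N) <= s},
     {subset s <= e M} & w N = \sum_(x <- s) F x]) ->
  w @ \oo --> l.
Proof.
move=> uniq_e sub_e; set a := (fun N => \sum_(x <- e N) `|F x|).
move=> su ul b_oo ws.
have cb : a (b N) @[N --> \oo] --> limn a by exact: (cvg_comp _ _ b_oo su).
have ub : \sum_(x <- e (b N)) F x @[N --> \oo] --> l.
  exact: (cvg_comp _ _ b_oo ul).
have le_a M : a M <= limn a.
  apply: nondecreasing_cvgn_le => // N M' leNM.
  by rewrite /a (sum_sub_uniq _ (uniq_e N) (uniq_e M') (sub_e _ _ leNM)) lerDl
    sumr_ge0.
have d0 : (w N - \sum_(x <- e (b N)) F x) @[N --> \oo] --> (0 : R).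
  apply/norm_cvg0P.
  apply: (@squeeze_cvgr _ _ _ _ (cst 0) (fun N => limn a - a (b N))).
  - apply: nearW => N; rewrite normr_ge0/=.
    have [M [s [us sub1 sub2 ->]]] := ws N.
    have /le_trans -> // := sum_between F (uniq_e _) us (uniq_e _) sub1 sub2.
    by rewrite lerB// le_a.
  - exact: cvg_cst.
  - rewrite -[X in _ --> X](subrr (limn a)); apply: cvgB => //.
    exact: cvg_cst.
have -> : w = (fun N => (w N - \sum_(x <- e (b N)) F x)
                        + \sum_(x <- e (b N)) F x).
  by apply/funext => N; rewrite subrK.
by rewrite -[l]add0r; apply: cvgD.
Qed.

Lemma box_sum_nondecreasing u :
  (forall alpha, 0 <= u alpha) -> nondecreasing_seq (box_sum u).
Proof.
move=> u_ge0 N M leNM; rewrite !box_sumE.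
rewrite (sum_sub_uniq u (box_uniq N) (box_uniq M) (sub_box leNM)).
by rewrite lerDl sumr_ge0.
Qed.

Definition abs_summable u := cvgn (box_sum (fun alpha => `|u alpha|)).

Lemma abs_summable_le u v :
  (forall alpha, `|u alpha| <= v alpha) -> cvgn (box_sum v) -> abs_summable u.
Proof.
move=> le_uv cv; apply: nondecreasing_is_cvgn.
  exact: box_sum_nondecreasing.
exists (limn (box_sum v)) => _ [N _ <-].
apply: (@le_trans _ _ (box_sum v N)).
  by rewrite !box_sumE ler_sum.
apply: nondecreasing_cvgn_le => //; apply: box_sum_nondecreasing => a.
exact: le_trans (le_uv a).
Qed.

Lemma abs_sums_to_ex u : abs_summable u -> exists l, abs_sums_to u l.
Proof.
move=> su; suff cu : cvgn (box_sum u) by exists (limn (box_sum u)).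
(* The terms [|u| + u] are nonnegative and dominated by [2 |u|]. *)
have cv : cvgn (box_sum (fun alpha => `|u alpha| + u alpha)).
  have le2 alpha : `| `|u alpha| + u alpha| <= 2 * `|u alpha|.
    by rewrite (le_trans (ler_normD _ _))// normr_id mulr_natl mulr2n.
  have := abs_summable_le le2.
  have -> : box_sum (fun alpha => 2 * `|u alpha|)
      = (fun N => 2 * box_sum (fun alpha => `|u alpha|) N).
    by apply/funext => N; rewrite /box_sum mulr_sumr.
  have H : cvgn (fun N => 2 * box_sum (fun alpha => `|u alpha|) N).
    by apply: is_cvgMr; exact: su.
  move=> /(_ H); rewrite /abs_summable; 
  have -> // : (fun alpha => `| `|u alpha| + u alpha|)
     = (fun alpha => `|u alpha| + u alpha).
  apply/funext => alpha; rewrite ger0_norm//.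
  by rewrite -lerBlDr sub0r lerNl; exact: lerNnormlW.
have -> : box_sum u = box_sum (fun alpha => `|u alpha| + u alpha)
                    - box_sum (fun alpha => `|u alpha|).
  apply/funext => N; rewrite -[RHS]/(box_sum _ N - box_sum _ N) -sumrB.
  by apply: eq_bigr => a _; rewrite addrAC subrr add0r.
exact: is_cvgB.
Qed.

Lemma abs_sums_to_unique u l l' : abs_sums_to u l -> abs_sums_to u l' -> l = l'.
Proof. by move=> [_ ul] [_ ul']; exact: cvg_unique ul ul'. Qed.

Lemma abs_sums_toD u v l m : abs_sums_to u l -> abs_sums_to v m ->
  abs_sums_to (fun alpha => u alpha + v alpha) (l + m).
Proof.
move=> [su ul] [sv vm]; split.
  apply: (@abs_summable_le _ (fun a => `|u a| + `|v a|)).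
    by move=> a; exact: ler_normD.
  have -> : box_sum (fun a => `|u a| + `|v a|)
     = box_sum (fun a => `|u a|) + box_sum (fun a => `|v a|).
    by apply/funext => N; rewrite /box_sum big_split.
  exact: is_cvgD.
have -> : box_sum (fun a => u a + v a) = box_sum u + box_sum v.
  by apply/funext => N; rewrite /box_sum big_split.
exact: cvgD.
Qed.

Lemma abs_sums_toZ u l (k : R) : abs_sums_to u l ->
  abs_sums_to (fun alpha => k * u alpha) (k * l).
Proof.
have E (w : ('I_n -> nat) -> R) (t : R) :
    box_sum (fun a => t * w a) = (fun N => t * box_sum w N).
  by apply/funext => N; rewrite /box_sum mulr_sumr.
move=> [su ul]; split.
  apply: (@abs_summable_le _ (fun a => `|k| * `|u a|)).
    by move=> a; rewrite normrM.
  by rewrite E; apply: is_cvgMr.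
by rewrite E; apply: cvgMr.
Qed.

Lemma abs_sums_to_sum (J : Type) (s : seq J) (u : J -> ('I_n -> nat) -> R)
    (l : J -> R) : (forall j, abs_sums_to (u j) (l j)) ->
  abs_sums_to (fun alpha => \sum_(j <- s) u j alpha) (\sum_(j <- s) l j).
Proof.
move=> ul; elim: s => [|j s IHs].
  rewrite big_nil; have -> : (fun alpha => \sum_(j <- [::]) u j alpha) = cst 0.
    by apply/funext => a; rewrite big_nil.
  have E : @box_sum R n (cst 0) = (cst 0 : nat -> R).
    by apply/funext => N; rewrite /box_sum big1.
  split; last by rewrite E; exact: cvg_cst.
  have -> : (fun a : 'I_n -> nat => `|cst (0 : R) a|) = cst 0.
    by apply/funext => a; rewrite normr0.
  by rewrite E; exact: is_cvg_cst.
rewrite big_cons; have -> : (fun alpha => \sum_(j <- j :: s) u j alpha)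
    = (fun alpha => u j alpha + \sum_(j <- s) u j alpha).
  by apply/funext => a; rewrite big_cons.
exact: abs_sums_toD.
Qed.

Lemma abs_sums_to_norm_le u v l m : (forall alpha, `|u alpha| <= v alpha) ->
  abs_sums_to u l -> abs_sums_to v m -> `|l| <= m.
Proof.
move=> le_uv [_ ul] [_ vm].
have cul : (`|box_sum u N| @[N --> \oo] --> `|l|) by exact: cvg_norm.
apply: (ler_cvg_to cul vm); apply: nearW => N; rewrite /box_sum.
by rewrite (le_trans (ler_norm_sum _ _ _))// ler_sum.
Qed.


End BoxSums.

(** * Index shifts and Cauchy products *)

Section Shift.
Context {R : realType} {n : nat}.
Implicit Types (u v : ('I_n -> nat) -> R) (alpha beta : 'I_n -> nat).

Definition shift_idx (i : 'I_n) alpha : 'I_n -> nat :=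
  fun j => (alpha j + (j == i))%N.

Lemma shift_idx_inj i : injective (shift_idx i).
Proof.
move=> a b eq_ab; apply/funext => j.
by have /addIn := congr1 (fun f => f j) eq_ab.
Qed.

Lemma shift_idx_onto i beta : (0 < beta i)%N ->
  beta = shift_idx i (fun j => (beta j - (j == i))%N).
Proof.
move=> b_gt0; apply/funext => j; rewrite /shift_idx subnK//.
by have [->|] := eqVneq.
Qed.

(** The shift reaches exactly the exponents with a positive [i]-th entry.
Adding those with entry zero, where [u] vanishes, gives sets between two
consecutive boxes. *)
Lemma cvg_box_sum_shift i u l : (forall alpha, alpha i = 0%N -> u alpha = 0) ->
  abs_sums_to u l -> box_sum (u \o shift_idx i) @ \oo --> l.
Proof.
move=> u0 [su ul].
apply: (@cvg_sum_between _ _ u box _ _ id).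
- exact: box_uniq.
- exact: sub_box.
- by under eq_fun do rewrite -box_sumE; exact: su.
- by under eq_fun do rewrite -box_sumE; exact: ul.
- exact: cvg_id.
move=> N; exists N.+1.
exists (map (shift_idx i) (box N) ++ [seq b <- box N | b i == 0%N]); split.
- rewrite cat_uniq (map_inj_uniq (@shift_idx_inj i)) box_uniq filter_uniq
  ?box_uniq//.
  rewrite andbT/=; apply/hasPn => b; rewrite mem_filter => /andP[/eqP bi0 _].
  by apply/mapP => -[a _ eq_b]; move: bi0; rewrite eq_b /shift_idx eqxx addn1.
- move=> b bN; rewrite mem_cat mem_filter bN andbT orbC.
  have [//|bi_gt0/=] := posnP (b i).
  apply/mapP; exists (fun j => (b j - (j == i))%N); last exact: shift_idx_onto.
  apply/mem_box => j; rewrite (leq_ltn_trans (leq_subr _ _))//.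
  by move/mem_box : bN; apply.
- move=> b; rewrite mem_cat => /orP[/mapP[a /mem_box aN ->]|].
    apply/mem_box => j; rewrite /shift_idx -(addn1 N) -addSn leq_add//.
    by case: (j == i).
  by rewrite mem_filter => /andP[_]; apply: sub_box.
- rewrite box_sumE big_cat/= big_map [X in _ + X]big1_seq ?addr0//.
  by move=> b /=; rewrite mem_filter => /andP[/eqP bi0 _]; exact: u0.
Qed.

Lemma abs_sums_to_norm u l : abs_sums_to u l ->
  exists m, abs_sums_to (fun alpha => `|u alpha|) m.
Proof.
move=> [su _]; exists (limn (box_sum (fun alpha => `|u alpha|))).
by split=> //; under [X in box_sum X]eq_fun do rewrite normr_id; exact: su.
Qed.

Lemma abs_sums_to_shift i u l : (forall alpha, alpha i = 0%N -> u alpha = 0) ->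
  abs_sums_to u l -> abs_sums_to (u \o shift_idx i) l.
Proof.
move=> u0 ul; split; last exact: cvg_box_sum_shift.
have [m um] := abs_sums_to_norm ul.
apply: (cvgP m); apply: (@cvg_box_sum_shift i (fun alpha => `|u alpha|)) um.
by move=> a /u0 ->; rewrite normr0.
Qed.

End Shift.

Section Convolution.
Context {R : realType} {n : nat}.
Implicit Types (u v : ('I_n -> nat) -> R) (alpha beta gamma : 'I_n -> nat).

Definition le_idx alpha gamma : bool := [forall i, (alpha i <= gamma i)%N].

Definition add_idx alpha beta : 'I_n -> nat := fun i => (alpha i + beta i)%N.
Definition sub_idx alpha beta : 'I_n -> nat := fun i => (alpha i - beta i)%N.

Lemma add_idxK alpha : cancel (add_idx alpha) (sub_idx^~ alpha).
Proof. by move=> b; apply/funext => i; rewrite /sub_idx /add_idx addKn. Qed.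

Lemma sub_idxK alpha gamma : le_idx alpha gamma ->
  add_idx alpha (sub_idx gamma alpha) = gamma.
Proof.
by move=> /forallP le_ag; apply/funext => i; rewrite /add_idx subnKC.
Qed.

(** Cauchy product: the box is chosen large enough to hold every exponent
below [gamma]. *)
Definition conv u v gamma : R :=
  \sum_(alpha <- box (\max_i gamma i).+1 | le_idx alpha gamma)
     u alpha * v (sub_idx gamma alpha).

Lemma conv_box u v gamma N : gamma \in box N ->
  conv u v gamma = \sum_(alpha <- box N | le_idx alpha gamma)
                     u alpha * v (sub_idx gamma alpha).
Proof.
move=> /mem_box gammaN; rewrite /conv -[LHS]big_filter -[RHS]big_filter.
apply: perm_big; apply: uniq_perm; rewrite ?filter_uniq ?box_uniq// => a.
rewrite !mem_filter; have [/forallP le_ag/=|//] := boolP (le_idx a gamma).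
apply/idP/idP => _; apply/mem_box => i.
  exact: leq_ltn_trans (le_ag i) (gammaN i).
by rewrite ltnS (leq_trans (le_ag i))// leq_bigmax.
Qed.

Lemma box_sum_conv u v N : box_sum (conv u v) N =
  \sum_(p <- [seq p <- [seq (a, b) | a <- box N, b <- box N]
               | add_idx p.1 p.2 \in box N]) u p.1 * v p.2.
Proof.
rewrite big_filter big_mkcond big_allpairs box_sumE.
rewrite (eq_big_seq _ (fun g => @conv_box u v g N)).
under eq_bigr => g _ do rewrite big_mkcond.
rewrite exchange_big/=; apply: eq_bigr => a _.
rewrite -!big_mkcond/= -[LHS]big_filter -[RHS]big_filter.
rewrite (@perm_big _ _ _ _ _ (map (add_idx a)
    [seq b <- box N | add_idx a b \in box N])).
  by rewrite big_map; apply: eq_bigr => b _; rewrite add_idxK.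
apply: uniq_perm; rewrite ?filter_uniq ?box_uniq//.
  rewrite map_inj_uniq ?filter_uniq ?box_uniq//; exact: can_inj (@add_idxK a).
move=> g; rewrite mem_filter; apply/andP/mapP => [[le_ag gN]|[b]].
  exists (sub_idx g a); last by rewrite sub_idxK.
  rewrite mem_filter sub_idxK// gN/=; apply/mem_box => i.
  by rewrite (leq_ltn_trans (leq_subr _ _))//; move/mem_box: gN; apply.
rewrite mem_filter => /andP[abN bN] ->; split => //.
by apply/forallP => i; rewrite leq_addr.
Qed.

Lemma box_sumM u v N : box_sum u N * box_sum v N =
  \sum_(p <- [seq (a, b) | a <- box N, b <- box N]) u p.1 * v p.2.
Proof.
rewrite !box_sumE big_allpairs mulr_suml; apply: eq_bigr => a _.
by rewrite mulr_sumr.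
Qed.

Lemma half_cvgn : (fun N : nat => N./2) @ \oo --> \oo.
Proof.
move=> A [N _ NA]; exists N.*2 => // M /= leNM; apply: NA => /=.
by rewrite -[N]doubleK half_leq.
Qed.

(** The pairs of exponents whose sum lies in a box contain all pairs of
exponents in the box of half the size, and are pairs of exponents in the box
itself. *)
Lemma cvg_box_sum_conv u v l m : abs_sums_to u l -> abs_sums_to v m ->
  box_sum (conv u v) @ \oo --> l * m.
Proof.
move=> [su ul] [sv vm].
apply: (@cvg_sum_between _ _ (fun p => u p.1 * v p.2)
  (fun N => [seq (a, b) | a <- box N, b <- box N]) _ _ half).
- by move=> N; rewrite allpairs_uniq ?box_uniq// => -[? ?] [? ?] _ _ [-> ->].
- move=> N M leNM _ /allpairsP[[a b]/= [aN bN ->]]; apply/allpairsP.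
  by exists (a, b); split=> //=; apply: sub_box leNM _ _.
- under eq_fun => N do under eq_bigr do rewrite normrM.
  under eq_fun do rewrite -(box_sumM (fun a => `|u a|) (fun a => `|v a|)).
  exact: is_cvgM.
- by under eq_fun do rewrite -box_sumM; exact: cvgM.
- exact: half_cvgn.
move=> N; exists N.
exists [seq p <- [seq (a, b) | a <- box N, b <- box N]
             | add_idx p.1 p.2 \in box N]; split.
- rewrite filter_uniq// allpairs_uniq ?box_uniq// => -[? ?] [? ?] _ _ [->
  ->] //.
- move=> _ /allpairsP[[a b]/= [aN bN ->]]; rewrite mem_filter/=.
  have half_le : (N./2 <= N)%N.
    by rewrite -[leqRHS]odd_double_half -addnn addnA leq_addl.
  apply/andP; split; last first.
    by apply/allpairsP; exists (a, b); split=> //=; apply: sub_box half_le _ _.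
  apply/mem_box => i; move/mem_box/(_ i): aN; move/mem_box/(_ i): bN.
  rewrite /add_idx => bN aN.
  rewrite -[ltnRHS]odd_double_half (@leq_trans (N./2 + N./2)%N) ?addnn
    ?leq_addl//.
  by rewrite -addnn -addSn leq_add// ltnW.
- by move=> p; rewrite mem_filter => /andP[].
- exact: box_sum_conv.
Qed.

Lemma abs_sums_toM u v l m : abs_sums_to u l -> abs_sums_to v m ->
  abs_sums_to (conv u v) (l * m).
Proof.
move=> ul vm; split; last exact: cvg_box_sum_conv.
have [l' ul'] := abs_sums_to_norm ul; have [m' vm'] := abs_sums_to_norm vm.
apply: (@abs_summable_le _ _ _ (conv (fun a => `|u a|) (fun a => `|v a|))).
  move=> g; rewrite (le_trans (ler_norm_sum _ _ _))//.
  by apply: ler_sum => a _; rewrite normrM.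
exact: cvgP (cvg_box_sum_conv ul' vm').
Qed.

End Convolution.

(** * First-order expansion of power series *)

Section Monomials.
Context {R : realType} {n : nat}.
Implicit Types (s h x a : 'rV[R]_n) (alpha beta : 'I_n -> nat).

Lemma monomial_add_idx s alpha beta :
  monomial s (add_idx alpha beta) = monomial s alpha * monomial s beta.
Proof.
by rewrite /monomial -big_split; apply: eq_bigr => i _; rewrite exprD.
Qed.

(** The [i]-th partial derivative of the monomial [alpha]; the subtraction is
truncated only where the factor [alpha i] vanishes. *)
Definition dmonomial (i : 'I_n) s alpha : R :=
  (alpha i)%:R * \prod_j s 0 j ^+ (alpha j - (j == i)).

Lemma dmonomial_shift i s alpha :
  dmonomial i s (shift_idx i alpha) = (alpha i).+1%:R * monomial s alpha.
Proof.
rewrite /dmonomial /shift_idx eqxx addn1; congr (_ * _).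
by apply: eq_bigr => j _; rewrite addnK.
Qed.

(** First order expansion of a product under perturbations of relative size
[t]; the bounds are stable under multiplication by one more factor. *)
Definition taylor1 (t B P P' Q : R) : Prop :=
  [/\ `|P| <= B, `|Q| <= B, `|P'| <= t * B,
      `|Q - P| <= t * B & `|Q - P - P'| <= t ^+ 2 * B].

Lemma taylor1_mul (t sigma eta B P P' Q y k : R) :
  0 <= t <= 1 -> 0 <= sigma -> 0 <= eta ->
  `|y| <= sigma -> `|k| <= t * eta ->
  taylor1 t B P P' Q ->
  taylor1 t ((sigma + eta) * B) (y * P) (k * P + y * P') ((y + k) * Q).
Proof.
move=> /andP[t0 t1] s0 e0 ys kt [P1 Q1 P'1 D1 D2].
have B0 : 0 <= B by apply: le_trans P1.
have te : t * eta <= eta by rewrite ler_piMl.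
have M (a b c d : R) : `|a| <= c -> `|b| <= d -> `|a * b| <= c * d.
  by move=> ac bd; rewrite normrM ler_pM.
split.
- by rewrite (le_trans (M _ _ _ _ ys P1))// ler_wpM2r// lerDl.
- apply: M => //; rewrite (le_trans (ler_normD _ _))// lerD//.
  exact: le_trans kt te.
- rewrite (le_trans (ler_normD _ _))// (le_trans (lerD (M _ _ _ _ kt P1) (M _ _
  _ _ ys P'1)))//.
  by rewrite le_eqVlt; apply/orP; left; apply/eqP; ring.
- have -> : (y + k) * Q - y * P = y * (Q - P) + k * Q by ring.
  rewrite (le_trans (ler_normD _ _))// (le_trans (lerD (M _ _ _ _ ys D1) (M _ _
    _ _ kt Q1)))//.
  by rewrite le_eqVlt; apply/orP; left; apply/eqP; ring.
- have -> : (y + k) * Q - y * P - (k * P + y * P') = y * (Q - P - P') + k * (Q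
  - P).
    by ring.
  rewrite (le_trans (ler_normD _ _))// (le_trans (lerD (M _ _ _ _ ys D2) (M _ _
    _ _ kt D1)))//.
  by rewrite le_eqVlt; apply/orP; left; apply/eqP; ring.
Qed.

Lemma taylor1_mulX (t sigma eta B P P' Q y k : R) (m : nat) :
  0 <= t <= 1 -> 0 <= sigma -> 0 <= eta ->
  `|y| <= sigma -> `|k| <= t * eta ->
  taylor1 t B P P' Q ->
  taylor1 t ((sigma + eta) ^+ m * B) (y ^+ m * P)
    (k * m%:R * y ^+ (m - 1) * P + y ^+ m * P') ((y + k) ^+ m * Q).
Proof.
move=> t01 s0 e0 ys kt T; elim: m => [|m IHm].
  by rewrite !expr0 !mul1r mulr0 !mul0r add0r.
have := taylor1_mul t01 s0 e0 ys kt IHm.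
rewrite !mulrA -!exprS; congr (taylor1 _ _ _ _ _).
rewrite subn1 /= -[m.+1%:R]natr1; case: m {IHm} => [|m].
  by rewrite !expr0 expr1; ring.
rewrite subn1 /= !exprS; ring.
Qed.

Lemma monomial_taylor1 (t sigma eta : R) s h alpha :
  0 <= t <= 1 -> 0 <= sigma -> 0 <= eta ->
  (forall i, `|s 0 i| <= sigma) -> (forall i, `|h 0 i| <= t * eta) ->
  taylor1 t (monomial (const_mx (sigma + eta)) alpha) (monomial s alpha)
    (\sum_i h 0 i * dmonomial i s alpha) (monomial (s + h) alpha).
Proof.
move=> t01 s0 e0 s_le h_le.
suff H (r : seq 'I_n) : uniq r ->
    taylor1 t (\prod_(j <- r) (sigma + eta) ^+ alpha j)
      (\prod_(j <- r) s 0 j ^+ alpha j)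
      (\sum_(i <- r) h 0 i * ((alpha i)%:R
          * \prod_(j <- r) s 0 j ^+ (alpha j - (j == i))))
      (\prod_(j <- r) (s + h) 0 j ^+ alpha j).
  have := H _ (index_enum_uniq _); rewrite /monomial /dmonomial.
  by congr (taylor1 _ _ _ _ _); apply: eq_bigr => i _; rewrite mxE.
elim: r => [_|k r IHr /= /andP[kr /IHr{}IHr]].
  rewrite !big_nil; have /andP[t0 t1] := t01.
  by rewrite /taylor1 !subrr !normr1 normr0 !mulr1 sqr_ge0 t0.
have := taylor1_mulX (alpha k) t01 s0 e0 (s_le k) (h_le k) IHr.
rewrite !big_cons; congr (taylor1 _ _ _ _ _); last by rewrite mxE.
congr (_ + _).
  rewrite eqxx -!mulrA; congr (_ * (_ * (_ * _))).
  apply: eq_big_seq => j jr.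
  by have [jk|] := eqVneq j k; [rewrite jk (negPf kr) in jr|rewrite subn0].
rewrite mulr_sumr; apply: eq_big_seq => i ir; rewrite big_cons.
have -> : (k == i) = false.
  by apply: contraNF kr => /eqP ->.
by rewrite subn0; ring.
Qed.

End Monomials.

Section PowerSeries.
Context {R : realType} {n : nat}.
Implicit Types (f g : 'rV[R]_n -> R) (a x h : 'rV[R]_n) (c : ('I_n -> nat) ->
  R).

Definition polydisc a (r : R) : set 'rV[R]_n :=
  [set x | forall i, `|x 0 i - a 0 i| < r].

Definition has_expansion f a c (r : R) : Prop := 0 < r /\
  forall x, polydisc a r x ->
    abs_sums_to (fun alpha => c alpha * monomial (x - a) alpha) (f x).

(** Coefficients of the termwise [i]-th partial derivative. *)
Definition dcoef (i : 'I_n) c : ('I_n -> nat) -> R :=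
  fun alpha => (alpha i).+1%:R * c (shift_idx i alpha).

(** Inside the polydisc, at a point with room [eta] to spare, the remainder of
order two of each monomial is at most [t ^+ 2] times a term of the convergent
series of absolute values at the slightly larger radius [sigma + eta]. *)
Lemma expansion_taylor f a c (r : R) x : has_expansion f a c r ->
  polydisc a r x ->
  exists (l : 'I_n -> R) (C eta : R), [/\
    forall i, abs_sums_to (fun alpha => dcoef i c alpha * monomial (x - a)
      alpha) (l i),
    0 < eta, 0 <= C &
    forall (t : R) h, 0 <= t <= 1 -> (forall i, `|h 0 i| <= t * eta) ->
      `|f (x + h) - f x - \sum_i h 0 i * l i| <= t ^+ 2 * C].
Proof.
move=> [r0 fE] xr.
pose sigma : R := \big[Num.max/0]_i `|(x - a) 0 i|.
have s_lt : sigma < r by apply: bigmax_lt => // i _; rewrite !mxE; exact: xr.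
have s_ge0 : 0 <= sigma by exact: bigmax_ge_id.
pose eta : R := (r - sigma) / 2.
have eta_gt0 : 0 < eta by rewrite divr_gt0// subr_gt0.
have rho_lt : sigma + eta < r by rewrite /eta; lra.
have s_le i : `|(x - a) 0 i| <= sigma by exact: le_bigmax.
pose B := monomial (const_mx (sigma + eta) : 'rV[R]_n).
have B_ge0 alpha : 0 <= B alpha.
  by apply: prodr_ge0 => i _; rewrite exprn_ge0// mxE addr_ge0// ltW.
have [C CE] : exists C, abs_sums_to (fun alpha => `|c alpha| * B alpha) C.
  have in_disc : polydisc a r (a + const_mx (sigma + eta)).
    by move=> i; rewrite !mxE addrAC subrr add0r ger0_norm// addr_ge0// ltW.
  have [C CE] := abs_sums_to_norm (fE _ in_disc); exists C.
  move: CE; congr (abs_sums_to _ _); apply/funext => alpha.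
  by rewrite normrM addrAC subrr add0r [`|monomial _ _|]ger0_norm.
have T (t : R) h alpha (t01 : 0 <= t <= 1) (h_le : forall i,
  `|h 0 i| <= t * eta) :=
  monomial_taylor1 alpha t01 s_ge0 (ltW eta_gt0) s_le h_le.
have [l lE] : exists l : 'I_n -> R, forall i,
    abs_sums_to (fun alpha => c alpha * dmonomial i (x - a) alpha) (l i).
  suff /choice[l lE] : forall i, exists l : R, 
      abs_sums_to (fun alpha => c alpha * dmonomial i (x - a) alpha) l.
    by exists l.
  move=> i; apply: abs_sums_to_ex.
  apply: (@abs_summable_le _ _ _ (fun alpha => eta^-1 * (`|c alpha| * B
    alpha))).
    move=> alpha; rewrite normrM mulrCA ler_wpM2l// ler_pdivlMl//.
    (* The bound on the linear part, read at the displacement [eta *: 'e_i]. *)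
    have h_le j : `|(eta *: delta_mx 0 i : 'rV[R]_n) 0 j| <= 1 * eta.
      rewrite !mxE eqxx mul1r normrM (gtr0_norm eta_gt0) ler_piMr ?(ltW
        eta_gt0)//.
      by case: (j == i); rewrite ?normr1 ?normr0.
    have t01 : 0 <= (1 : R) <= 1 by rewrite ler01 lexx.
    have [_ _ + _ _] := T 1 _ alpha t01 h_le.
    rewrite mul1r (bigD1 i)//= big1 ?addr0; last first.
      by move=> j /negPf ji; rewrite !mxE ji mulr0 mul0r.
    by rewrite !mxE !eqxx mulr1 normrM gtr0_norm.
  by have [_ /cvgP] := abs_sums_toZ eta^-1 CE.
exists l, C, eta; split => //.
- move=> i; have /(@abs_sums_to_shift _ _ i) : forall alpha, alpha i = 0%N ->
      c alpha * dmonomial i (x - a) alpha = 0.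
    by move=> alpha ai0; rewrite /dmonomial ai0 mul0r mulr0.
  move=> /(_ _ (lE i)); congr (abs_sums_to _ _); apply/funext => alpha.
  by rewrite /= dmonomial_shift /dcoef mulrA [c _ * _]mulrC.
- apply: le_trans (normr_ge0 C) (abs_sums_to_norm_le _ CE CE) => alpha.
  by rewrite ger0_norm// mulr_ge0.
move=> t h t01 h_le.
have xh_disc : polydisc a r (x + h).
  move=> i; rewrite !mxE addrAC (le_lt_trans _ rho_lt)//.
  rewrite (le_trans (ler_normD _ _))// lerD//.
    by have := s_le i; rewrite !mxE.
  by rewrite (le_trans (h_le i))// ler_piMl ?(ltW eta_gt0)//; case/andP: t01.
have D := abs_sums_toD (fE _ xh_disc) (abs_sums_toZ (-1) (abs_sums_toD (fE _ xr)
  (abs_sums_to_sum (index_enum _) (fun i => abs_sums_toZ (h 0 i) (lE i))))).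
rewrite -addrA -opprD -mulN1r.
apply: (abs_sums_to_norm_le _ D (abs_sums_toZ (t ^+ 2) CE)) => alpha.
have [_ _ _ _ T2] := T _ _ alpha t01 h_le.
rewrite [leRHS]mulrCA (le_trans _ (ler_wpM2l (normr_ge0 (c alpha)) T2))//.
rewrite -normrM le_eqVlt; apply/orP; left; apply/eqP; congr (`|_|).
rewrite !mulrBr mulr_sumr mulN1r opprD addrA [x + h - a]addrAC.
congr (_ - _ - _).
by apply: eq_bigr => i _; rewrite mulrCA.
Qed.

End PowerSeries.

(** * Analytic functions of several variables *)

Section Differentiability.
Context {R : realType} {n : nat}.
Implicit Types (f g : 'rV[R]_n -> R) (a x h : 'rV[R]_n) (c : ('I_n -> nat) ->
  R).

Lemma coord_le_norm h i : `|h 0 i| <= `|h|.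
Proof.
rewrite [leRHS]/Num.Def.normr/= mx_normrE.
exact: (le_bigmax _ (fun ij : 'I_1 * 'I_n => `|h ij.1 ij.2|) (0, i)).
Qed.

Lemma norm_lt_polydisc a x (r : R) : `|x - a| < r -> polydisc a r x.
Proof.
by move=> xr i; have := coord_le_norm (x - a) i;
  rewrite !mxE => /le_lt_trans ->.
Qed.

Lemma polydisc_norm_lt a x (r : R) : 0 < r -> polydisc a r x -> `|x - a| < r.
Proof.
move=> r0 xr; rewrite [ltLHS]/Num.Def.normr/= mx_normrE.
by apply: bigmax_lt => // -[i j] _ /=; rewrite (ord1 i) !mxE; exact: xr.
Qed.

Lemma near_polydisc a (r : R) : 0 < r -> \forall x \near a, polydisc a r x.
Proof.
move=> r0; have := nbhsx_ballx a r r0; rewrite -nbhs_nearE; apply: filterS => x.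
rewrite -ball_normE/= distrC; exact: norm_lt_polydisc.
Qed.

Definition linear_form (l : 'I_n -> R) (h : 'rV[R]_n) : R := \sum_i h 0 i * l i.

Lemma linear_form_is_linear l : linear (linear_form l).
Proof.
move=> k u v; rewrite /linear_form scaler_sumr -big_split;
  apply: eq_bigr => i _.
by rewrite !mxE /GRing.scale/=; ring.
Qed.

HB.instance Definition _ l := GRing.isLinear.Build R 'rV[R]_n R *:%R
  (linear_form l) (linear_form_is_linear l).

Lemma linear_form_continuous l : continuous (linear_form l).
Proof.
move=> x; rewrite /linear_form.
apply: (cvg_big (@add_continuous R) (nbhs_filter x)) => i _.
by apply: cvgM; [exact: coord_continuous|exact: cvg_cst].
Qed.

(** The remainder of order two identifies the differential, whose coordinates
are the sums of the termwise partial derivatives. *)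
Lemma expansion_differentiable f a c (r : R) x : has_expansion f a c r ->
  polydisc a r x -> differentiable f x /\
  forall i, abs_sums_to (fun alpha => dcoef i c alpha * monomial (x - a) alpha)
    ('D_'e_i f x).
Proof.
move=> fE xr; have [l [C [eta [lE eta0 C0 T]]]] := expansion_taylor fE xr.
have small_o : f \o shift x = cst (f x) + linear_form l +o_ (0 : 'rV[R]_n) id.
  apply/eqaddoP => e e0.
  pose d := Num.min eta (e * eta ^+ 2 / (C + 1)).
  have d0 : 0 < d.
    rewrite lt_min eta0/= divr_gt0 ?ltr_wpDl//.
    by rewrite mulr_gt0// exprn_gt0.
  have := nbhsx_ballx (0 : 'rV[R]_n) d d0.
  rewrite -nbhs_nearE; apply: filterS => h.
  rewrite -ball_normE/= sub0r normrN lt_min => /andP[h_eta h_e].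
  have T1 : 0 <= `|h| / eta <= 1.
    by rewrite divr_ge0 ?(ltW eta0)//= ler_pdivrMr// mul1r ltW.
  have T2 i : `|h 0 i| <= `|h| / eta * eta.
    by rewrite divfK ?gt_eqF//; exact: coord_le_norm.
  have := T _ _ T1 T2; rewrite [x + h]addrC => /le_trans.
  rewrite -[`|(_ - _) h|]/(`|f (h + x) - (f x + linear_form l h)|) opprD addrA.
  apply.
  rewrite expr_div_n mulrAC ler_pdivrMr ?exprn_gt0// [leLHS]mulrC.
  rewrite [`|id h|]/(`|h|) mulrAC expr2 mulrA.
  apply: ler_wpM2r; first exact: (normr_ge0 (h : 'rV[R]_n)).
  have C1 : 0 < C + 1 by rewrite ltr_wpDl.
  move: h_e; rewrite ltr_pdivlMr// mulrC => /ltW; apply: le_trans.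
  by apply: ler_wpM2l; [exact: (normr_ge0 (h : 'rV[R]_n))|rewrite lerDl].
have diff_f : 'd f x = linear_form l :> (_ -> _).
  by apply: diff_unique small_o; exact: linear_form_continuous.
have df : differentiable f x.
  apply/diff_locallyP; rewrite diff_f; split=> //.
  exact: linear_form_continuous.
split=> // i; move: (lE i); rewrite deriveE// diff_f /= /linear_form.
rewrite (bigD1 i)//= mxE !eqxx mul1r big1 ?addr0// => j ji.
by rewrite mxE (negPf ji) andbF mul0r.
Qed.

Lemma has_expansion_partial f a c (r : R) i : has_expansion f a c r ->
  has_expansion ('D_'e_i f) a (dcoef i c) r.
Proof.
move=> fE; split; first by case: fE.
by move=> x xr; have [_] := expansion_differentiable fE xr; apply.
Qed.

Lemma analytic_at_differentiable f a : analytic_at f a -> differentiable f a.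
Proof.
move=> [c [r fE]]; have [] // := @expansion_differentiable f a c r a fE.
by move=> i; rewrite subrr normr0; case: fE.
Qed.

Lemma analytic_at_continuous f a : analytic_at f a -> {for a, continuous f}.
Proof. by move=> /analytic_at_differentiable/differentiable_continuous. Qed.

Lemma analytic_at_partial f a i : analytic_at f a -> analytic_at ('D_'e_i f) a.
Proof.
by move=> [c [r fE]]; exists (dcoef i c), r; apply: has_expansion_partial.
Qed.

Lemma dcoefC c i j : dcoef i (dcoef j c) = dcoef j (dcoef i c).
Proof.
apply/funext => alpha; rewrite /dcoef.
have -> : shift_idx j (shift_idx i alpha) = shift_idx i (shift_idx j alpha).
  by apply/funext => k; rewrite /shift_idx addnAC.
have [->//|ij] := eqVneq i j.
rewrite /shift_idx (eq_sym j i) (negPf ij) !addn0; ring.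
Qed.

(** Mixed second partials of a power series agree because termwise
differentiation commutes on coefficients. *)
Lemma analytic_at_partialC f a i j : analytic_at f a ->
  'D_'e_i ('D_'e_j f) a = 'D_'e_j ('D_'e_i f) a.
Proof.
move=> [c [r fE]]; have aa : polydisc a r a.
  by move=> k; rewrite subrr normr0; case: fE.
have [_ /(_ _ aa) Eij] := has_expansion_partial i (has_expansion_partial j fE).
have [_ /(_ _ aa) Eji] := has_expansion_partial j (has_expansion_partial i fE).
by move: Eij; rewrite dcoefC => Eij; exact: abs_sums_to_unique Eij Eji.
Qed.

End Differentiability.

Section AnalyticAlgebra.
Context {R : realType} {n : nat}.
Implicit Types (f g : 'rV[R]_n -> R) (a x h : 'rV[R]_n) (c : ('I_n -> nat) ->
  R).

Lemma near_analytic_at f g a : (\forall x \near a, f x = g x) ->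
  analytic_at f a -> analytic_at g a.
Proof.
move=> /nbhs_ballP[e /= e0 fg] [c [r [r0 fE]]].
exists c, (Num.min r e); split; first by rewrite lt_min r0.
move=> x xr; rewrite -fg; last first.
  rewrite -ball_normE/= distrC; apply: polydisc_norm_lt => // j.
  by have := xr j; rewrite lt_min => /andP[].
by apply: fE => i; have := xr i; rewrite lt_min => /andP[].
Qed.

Lemma cvg_box_sum0 (u : ('I_n -> nat) -> R) :
  (forall alpha, alpha != (fun=> 0%N) -> u alpha = 0) ->
  box_sum u @ \oo --> u (fun=> 0%N).
Proof.
move=> u0; apply: cvg_near_cst; exists 1%N => // -[//|N] _ /=.
rewrite box_sumE (bigD1_seq (fun=> 0%N)) ?box_uniq//=; last exact/mem_box.
by rewrite big1 ?addr0.
Qed.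

Lemma analytic_at_cst (k : R) a : analytic_at (cst k) a.
Proof.
pose c (alpha : 'I_n -> nat) : R := if alpha == (fun=> 0%N) then k else 0.
exists c, 1; split=> // x _.
pose u := fun alpha => c alpha * monomial (x - a) alpha.
have u0 alpha : alpha != (fun=> 0%N) -> u alpha = 0.
  by move=> /negPf nz; rewrite /u /c nz mul0r.
have ck : u (fun=> 0%N) = k.
  by rewrite /u /c eqxx /monomial big1 ?mulr1// => i _; rewrite expr0.
split; last by rewrite -[cst k x]ck; exact: cvg_box_sum0.
apply: cvgP; apply: (@cvg_box_sum0 (fun alpha => `|u alpha|)) => alpha /u0 ->.
by rewrite normr0.
Qed.

Lemma analytic_atD f g a : analytic_at f a -> analytic_at g a ->
  analytic_at (fun x => f x + g x) a.
Proof.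
move=> [c [r [r0 fE]]] [d [s [s0 gE]]].
exists (fun alpha => c alpha + d alpha), (Num.min r s).
split; first by rewrite lt_min r0.
move=> x xr.
have xc : polydisc a r x by move=> i; have := xr i; rewrite lt_min => /andP[].
have xd : polydisc a s x by move=> i; have := xr i; rewrite lt_min => /andP[].
have := abs_sums_toD (fE _ xc) (gE _ xd).
by congr (abs_sums_to _ _); apply/funext => al; rewrite mulrDl.
Qed.

Lemma analytic_atM f g a : analytic_at f a -> analytic_at g a ->
  analytic_at (fun x => f x * g x) a.
Proof.
move=> [c [r [r0 fE]]] [d [s [s0 gE]]].
exists (conv c d), (Num.min r s).
split; first by rewrite lt_min r0.
move=> x xr.
have xc : polydisc a r x by move=> i; have := xr i; rewrite lt_min => /andP[].
have xd : polydisc a s x by move=> i; have := xr i; rewrite lt_min => /andP[].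
have := abs_sums_toM (fE _ xc) (gE _ xd).
congr (abs_sums_to _ _); apply/funext => ga; rewrite /conv mulr_suml.
apply: eq_bigr => al /sub_idxK E.
have -> : monomial (x - a) ga
    = monomial (x - a) al * monomial (x - a) (sub_idx ga al).
  by rewrite -monomial_add_idx E.
by ring.
Qed.

Lemma analytic_at_sum (J : Type) (s : seq J) (f : J -> 'rV[R]_n -> R) a :
  (forall j, analytic_at (f j) a) ->
  analytic_at (fun x => \sum_(j <- s) f j x) a.
Proof.
move=> fa; elim: s => [|j s IHs].
  under [X in analytic_at X]eq_fun do rewrite big_nil; exact: analytic_at_cst.
under [X in analytic_at X]eq_fun do rewrite big_cons; exact: analytic_atD.
Qed.

Lemma analytic_atN f a : analytic_at f a -> analytic_at (fun x => - f x) a.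
Proof.
move=> fa; under [X in analytic_at X]eq_fun do rewrite -mulN1r.
by apply: analytic_atM => //; exact: analytic_at_cst.
Qed.

End AnalyticAlgebra.

(** * Differential calculus of analytic matrix-valued maps *)

Section MatrixCalculus.
Context {R : realType} {n : nat}.
Implicit Types (a x u v : 'rV[R]_n).

Definition mx_analytic_at p q (F : 'rV[R]_n -> 'M[R]_(p, q)) a : Prop :=
  forall i j, analytic_at (fun x => F x i j) a.

Lemma mulmx_rV_inj p (A B : 'M[R]_(n, p)) :
  (forall v : 'rV[R]_n, v *m A = v *m B) -> A = B.
Proof. by move=> AB; apply/row_matrixP => i; rewrite !rowE. Qed.

Lemma near_mx_analytic_at p q (F G : 'rV[R]_n -> 'M[R]_(p, q)) a :
  (\forall x \near a, F x = G x) -> mx_analytic_at F a -> mx_analytic_at G a.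
Proof.
move=> FG Fa i j; apply: near_analytic_at (Fa i j).
by apply: filterS FG => x ->.
Qed.

Lemma mx_analytic_at_derivable p q (F : 'rV[R]_n -> 'M[R]_(p, q)) a v :
  mx_analytic_at F a -> derivable F a v.
Proof.
move=> Fa; apply/derivable_mxP => i j.
exact/diff_derivable/analytic_at_differentiable.
Qed.

Lemma mx_analytic_at_mul p q r (F : 'rV[R]_n -> 'M[R]_(p, q))
    (G : 'rV[R]_n -> 'M[R]_(q, r)) a :
  mx_analytic_at F a -> mx_analytic_at G a ->
  mx_analytic_at (fun x => F x *m G x) a.
Proof.
move=> Fa Ga i j; under [X in analytic_at X]eq_fun do rewrite mxE.
by apply: analytic_at_sum => k; apply: analytic_atM.
Qed.

Lemma mx_analytic_at_add p q (F G : 'rV[R]_n -> 'M[R]_(p, q)) a :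
  mx_analytic_at F a -> mx_analytic_at G a ->
  mx_analytic_at (fun x => F x + G x) a.
Proof.
move=> Fa Ga i j; under [X in analytic_at X]eq_fun do rewrite mxE.
exact: analytic_atD.
Qed.

Lemma mx_analytic_at_opp p q (F : 'rV[R]_n -> 'M[R]_(p, q)) a :
  mx_analytic_at F a -> mx_analytic_at (fun x => - F x) a.
Proof.
move=> Fa i j; under [X in analytic_at X]eq_fun do rewrite mxE.
exact: analytic_atN.
Qed.

Lemma mx_analytic_at_tr p q (F : 'rV[R]_n -> 'M[R]_(p, q)) a :
  mx_analytic_at F a -> mx_analytic_at (fun x => (F x)^T) a.
Proof.
by move=> Fa i j; under [X in analytic_at X]eq_fun do rewrite mxE; exact: Fa.
Qed.

Lemma derive_mulmx p q r (F : 'rV[R]_n -> 'M[R]_(p, q))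
    (G : 'rV[R]_n -> 'M[R]_(q, r)) a v :
  derivable F a v -> derivable G a v ->
  'D_v (fun x => F x *m G x) a = 'D_v F a *m G a + F a *m 'D_v G a.
Proof.
move=> dF dG; have /derivable_mxP dFij := dF; have /derivable_mxP dGij := dG.
have FGE i j : (fun x => (F x *m G x) i j)
    = \sum_k ((fun x => F x i k) * (fun x => G x k j)).
  by apply/funext => x; rewrite fct_sumE mxE.
have dFG : derivable (fun x => F x *m G x) a v.
  apply/derivable_mxP => i j; rewrite FGE; apply: derivable_sum => k.
  exact: derivableM.
rewrite !derive_mx//; apply/matrixP => i j; rewrite !mxE FGE.
rewrite derive_sum; last by move=> k; exact: derivableM.
rewrite -big_split/=; apply: eq_bigr => k _.
by rewrite deriveM// !mxE addrC /GRing.scale/= [G a k j * _]mulrC.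
Qed.

Lemma mx_differentiable m (T : 'rV[R]_n -> 'rV[R]_m) a :
  mx_analytic_at T a -> differentiable T a.
Proof.
move=> Ta; have -> : T = \sum_k (fun x => T x 0 k *: 'e_k).
  apply/funext => x; rewrite fct_sumE; exact: row_sum_delta.
apply: differentiable_sum => k; apply: differentiableZl.
exact: analytic_at_differentiable.
Qed.

Lemma derive_jacobian m (T : 'rV[R]_n -> 'rV[R]_m) a v : mx_analytic_at T a ->
  'D_v T a = v *m 'J T a.
Proof. by move=> Ta; rewrite deriveEjacobian//; exact: mx_differentiable. Qed.

Lemma derive_partials (f : 'rV[R]_n -> R) a v : differentiable f a ->
  'D_v f a = \sum_i v 0 i * 'D_'e_i f a.
Proof.
move=> df; rewrite deriveE// {1}[v]row_sum_delta linear_sum;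
  apply: eq_bigr => i _.
by rewrite linearZ deriveE.
Qed.

Lemma jacobianE m (T : 'rV[R]_n -> 'rV[R]_m) a i k : mx_analytic_at T a ->
  ('J T a) i k = 'D_'e_i (fun x => T x 0 k) a.
Proof.
move=> Ta; have := derive_jacobian 'e_i Ta.
rewrite derive_mx; last exact: mx_analytic_at_derivable.
by move=> /matrixP/(_ 0 k); rewrite mxE -rowE mxE => ->.
Qed.

Lemma near_jacobianE m (T : 'rV[R]_n -> 'rV[R]_m) a i k :
  (\forall x \near a, mx_analytic_at T x) ->
  \forall x \near a, ('J T x) i k = 'D_'e_i (fun x => T x 0 k) x.
Proof. by apply: filterS => x Tx; exact: jacobianE. Qed.

Lemma mx_analytic_at_jacobian m (T : 'rV[R]_n -> 'rV[R]_m) a :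
  (\forall x \near a, mx_analytic_at T x) -> mx_analytic_at (fun x => 'J T x) a.
Proof.
move=> Ta i k; have /nbhs_singleton Taa := Ta.
apply: (@near_analytic_at _ _ ('D_'e_i (fun x => T x 0 k))).
  by have := near_jacobianE i k Ta; apply: filterS => x ->.
exact: analytic_at_partial.
Qed.

Lemma mx_analytic_at_derive p q (V : 'rV[R]_n -> 'rV[R]_n)
    (F : 'rV[R]_n -> 'M[R]_(p, q)) a :
  mx_analytic_at V a -> (\forall x \near a, mx_analytic_at F x) ->
  mx_analytic_at (fun x => 'D_(V x) F x) a.
Proof.
move=> Va Fa i j; have /nbhs_singleton Faa := Fa.
apply: (@near_analytic_at _ _
    (fun x => \sum_k V x 0 k * 'D_'e_k (fun x => F x i j) x)).
  apply: filterS Fa => x Fx.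
  rewrite derive_mx; last exact: mx_analytic_at_derivable.
  by rewrite mxE derive_partials//; exact: analytic_at_differentiable.
apply: analytic_at_sum => k; apply: analytic_atM => //.
exact: analytic_at_partial.
Qed.

Lemma derive_comp m (T : 'rV[R]_n -> 'rV[R]_m) (f : 'rV[R]_m -> R) a v :
  mx_analytic_at T a -> analytic_at f (T a) ->
  'D_v (f \o T) a = 'D_(v *m 'J T a) f (T a).
Proof.
move=> Ta fTa; have dT := mx_differentiable Ta.
have df := analytic_at_differentiable fTa.
have dfT : differentiable (f \o T) a by exact: differentiable_comp.
by rewrite [LHS](deriveE _ dfT) diff_comp// deriveE//= -derive_jacobian//
  deriveE.
Qed.

Lemma derivable_mx_comp m (T : 'rV[R]_n -> 'rV[R]_m) p q
    (F : 'rV[R]_m -> 'M[R]_(p, q)) a v : mx_analytic_at T a ->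
  (forall i j, analytic_at (fun y => F y i j) (T a)) -> derivable (F \o T) a v.
Proof.
move=> Ta FTa; apply/derivable_mxP => i j; apply: diff_derivable.
rewrite -[fun x => _]/((fun y => F y i j) \o T).
apply: differentiable_comp; first exact: mx_differentiable.
exact: analytic_at_differentiable.
Qed.

Lemma derive_mx_comp m (T : 'rV[R]_n -> 'rV[R]_m) p q
    (F : 'rV[R]_m -> 'M[R]_(p, q)) a v : mx_analytic_at T a ->
  (forall i j, analytic_at (fun y => F y i j) (T a)) ->
  'D_v (F \o T) a = 'D_(v *m 'J T a) F (T a).
Proof.
move=> Ta FTa; have dT := mx_differentiable Ta.
have dF i j : differentiable (fun y => F y i j) (T a).
  exact: analytic_at_differentiable.
have dFT i j : differentiable ((fun y => F y i j) \o T) a.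
  exact: differentiable_comp.
rewrite derive_mx; last first.
  by apply/derivable_mxP => i j; apply: diff_derivable; exact: dFT.
rewrite derive_mx; last first.
  by apply/derivable_mxP => i j; apply: diff_derivable; exact: dF.
by apply/matrixP => i j; rewrite mxE [RHS]mxE (derive_comp _ Ta (FTa i j)).
Qed.

(** The entries of the Jacobian are the first partial derivatives of [T], so
this is the equality of mixed second derivatives. *)
Lemma derive_jacobianC m (T : 'rV[R]_n -> 'rV[R]_m) a u v :
  (\forall x \near a, mx_analytic_at T x) ->
  u *m 'D_v (fun x => 'J T x) a = v *m 'D_u (fun x => 'J T x) a.
Proof.
move=> Ta; have Ja := mx_analytic_at_jacobian Ta.
have /nbhs_singleton Taa := Ta.
have DJ w i k : ('D_w (fun x => 'J T x) a) i k
    = \sum_j w 0 j * 'D_'e_j ('D_'e_i (fun x => T x 0 k)) a.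
  rewrite derive_mx; last exact: mx_analytic_at_derivable.
  rewrite mxE (near_eq_derive w (near_jacobianE i k Ta)) derive_partials//.
  exact/analytic_at_differentiable/analytic_at_partial.
move: (DJ v) (DJ u).
move: ('D_v (fun x => 'J T x) a) ('D_u (fun x => 'J T x) a) => A B AE BE.
apply/rowP => k; rewrite mxE [RHS]mxE.
transitivity (\sum_i \sum_j
    u 0 i * (v 0 j * 'D_'e_j ('D_'e_i (fun x => T x 0 k)) a)).
  by apply: eq_bigr => i _; rewrite AE mulr_sumr.
transitivity (\sum_i \sum_j
    v 0 i * (u 0 j * 'D_'e_j ('D_'e_i (fun x => T x 0 k)) a)); last first.
  by apply: eq_bigr => i _; rewrite BE mulr_sumr.
rewrite exchange_big/=; apply: eq_bigr => j _; apply: eq_bigr => i _.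
by rewrite analytic_at_partialC//; ring.
Qed.

End MatrixCalculus.

(** * Lie bracket and Lie derivative in charts *)

Section ChartCalculus.
Context {R : realType} {n : nat} (M : manifold R n).
Implicit Types (p q : M) (c : chart R n M) (f h : function M)
  (X Y : vector_field M) (theta : one_form M) (g : bilinear_field M).

Lemma chart_invK p c : charts_at p c -> chart_inv c (c p) = p.
Proof.
by move=> [/atlas_chart[_ _ cK _ _] cp]; apply: cK; rewrite inE.
Qed.

Lemma charts_at_chart_at p : charts_at p (chart_at p).
Proof. exact: svalP (cid (atlas_cover p)). Qed.

(** The statements hold near [c p] because chart images are open and the
inverse of a chart is continuous there. *)
Lemma near_charts_at p c c' : charts_at p c -> charts_at p c' ->
  \forall x \near c p, charts_at (chart_inv c x) c /\
    charts_at (chart_inv c x) c' /\ c (chart_inv c x) = x.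
Proof.
move=> pc pc'; case: (pc) (pc') => cA cp [cA' cp'].
have [_ open_img _ _ inv_cont] := atlas_chart cA.
have [open_dom' _ _ _ _] := atlas_chart cA'.
have img_p : chart_img c (c p) by exists p.
have near_img : \forall x \near c p, chart_img c x.
  exact: open_nbhs_nbhs.
have near_dom' : \forall x \near c p, chart_dom c' (chart_inv c x).
  move: inv_cont; rewrite continuous_open_subspace// => /(_ (c p)).
  rewrite inE => /(_ img_p); apply; rewrite (chart_invK pc).
  exact: open_nbhs_nbhs.
apply: filterS2 near_img near_dom' => x [q cq <-] dom'.
have qc : charts_at q c by [].
by rewrite (chart_invK qc) in dom' *.
Qed.

Definition components a b (F : M -> chart R n M -> 'M[R]_(a, b)) c :=
  fun x : 'rV[R]_n => F (chart_inv c x) c.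

Lemma analytic_components_at a b (F : M -> chart R n M -> 'M[R]_(a, b)) p c :
  analytic_components F -> charts_at p c ->
    mx_analytic_at (components F c) (c p).
Proof. by move=> aF [cA cp] i j; apply: aF => //; exists p. Qed.

Lemma near_analytic_components a b (F : M -> chart R n M -> 'M[R]_(a, b)) p c :
  analytic_components F -> charts_at p c ->
  \forall x \near c p, mx_analytic_at (components F c) x.
Proof.
move=> aF pc; have := near_charts_at pc pc; apply: filterS => x [xc [_ cx]].
rewrite -cx.
exact: (analytic_components_at aF xc).
Qed.

Lemma analytic_componentsP a b (F : M -> chart R n M -> 'M[R]_(a, b)) :
  (forall p c, charts_at p c -> mx_analytic_at (components F c) (c p)) ->
  analytic_components F.
Proof. by move=> aF c cA i j _ [p cp <-]; apply: aF. Qed.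

Definition transition c c' : 'rV[R]_n -> 'rV[R]_n := c' \o chart_inv c.

Lemma transitionE p c c' : charts_at p c -> transition c c' (c p) = c' p.
Proof. by move=> pc; rewrite /transition/= chart_invK. Qed.

Lemma near_transition_analytic p c c' : charts_at p c -> charts_at p c' ->
  \forall x \near c p, mx_analytic_at (transition c c') x.
Proof.
move=> pc pc'; have := near_charts_at pc pc'.
apply: filterS => x [xc [xc' cx]]; rewrite -cx => i j.
have [cA xd] := xc; have [cA' xd'] := xc'.
by have [tr _] := atlas_compatible cA cA'; apply: tr; exists (chart_inv c x).
Qed.

Lemma transition_analytic_at p c c' : charts_at p c -> charts_at p c' ->
  mx_analytic_at (transition c c') (c p).
Proof. by move=> pc pc'; exact: nbhs_singleton (near_transition_analytic pc
  pc'). Qed.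

Lemma near_vector_field X p c c' : analytic_vector_field X ->
  charts_at p c -> charts_at p c' ->
  \forall x \near c p,
    (components X c' \o transition c c') x
      = components X c x *m 'J (transition c c') x.
Proof.
move=> [trX _] pc pc'; have := near_charts_at pc pc';
  apply: filterS => x [xc [xc' cx]].
rewrite /components /= /transition/= (chart_invK xc') (trX _ _ _ xc xc').
by rewrite /jac cx.
Qed.

Lemma near_one_form theta p c c' : analytic_one_form theta ->
  charts_at p c -> charts_at p c' ->
  \forall x \near c p, components theta c x
      = 'J (transition c c') x *m (components theta c' \o transition c c') x.
Proof.
move=> [trT _] pc pc'; have := near_charts_at pc pc';
  apply: filterS => x [xc [xc' cx]].
rewrite /components /= /transition/= (chart_invK xc') (trT _ _ _ xc xc').
by rewrite /jac cx.
Qed.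

Lemma jacE p c c' : jac c c' p = 'J (transition c c') (c p).
Proof. by []. Qed.

Lemma componentsE a b (F : M -> chart R n M -> 'M[R]_(a, b)) p c :
  charts_at p c -> components F c (c p) = F p c.
Proof. by move=> pc; rewrite /components chart_invK. Qed.

Lemma mx_analytic_at_comp_transition a b (F : M -> chart R n M -> 'M[R]_(a, b))
    p c c' : analytic_components F -> charts_at p c -> charts_at p c' ->
  mx_analytic_at (components F c') (transition c c' (c p)).
Proof.
by move=> aF pc pc'; rewrite (transitionE _ pc); exact: analytic_components_at.
Qed.

(** In the chart [c'], [Y] is [Y *m 'J T] read through the transition [T]; the
chain and product rules give its derivative along [v]. *)
Lemma derive_vector_field_chart Y p c c' v : analytic_vector_field Y ->
  charts_at p c -> charts_at p c' ->
  'D_(v *m jac c c' p) (components Y c') (c' p)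
    = 'D_v (components Y c) (c p) *m jac c c' p
      + Y p c *m 'D_v (fun x => 'J (transition c c') x) (c p).
Proof.
move=> aY pc pc'; have Ta := transition_analytic_at pc pc'.
have nT := near_transition_analytic pc pc'.
have := near_eq_derive v (near_vector_field aY pc pc').
rewrite derive_mx_comp//; last first.
  by apply: mx_analytic_at_comp_transition => //; case: aY.
rewrite (transitionE _ pc) jacE => ->.
rewrite derive_mulmx ?(componentsE _ pc)//; apply: mx_analytic_at_derivable.
  by apply: analytic_components_at => //; case: aY.
exact: mx_analytic_at_jacobian.
Qed.

(** The second derivatives of the transition map enter both terms of the
bracket in the same way, since mixed partials agree, and cancel. *)
Lemma analytic_lie_bracket X Y : analytic_vector_field X ->
  analytic_vector_field Y -> analytic_vector_field (lie_bracket X Y).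
Proof.
move=> aX aY; split=> [p c c' pc pc'|].
  rewrite /lie_bracket -!/(components _ _).
  have [trX _] := aX; have [trY _] := aY.
  rewrite (trX _ _ _ pc pc') (trY _ _ _ pc pc') !derive_vector_field_chart//.
  rewrite (derive_jacobianC _ _ (near_transition_analytic pc pc')) mulmxBl.
  by rewrite opprD addrACA subrr addr0.
apply: analytic_componentsP => p c pc.
pose V x := 'D_(components X c x) (components Y c) x
          - 'D_(components Y c x) (components X c) x.
apply: (@near_mx_analytic_at _ _ _ _ V).
  have := near_charts_at pc pc; apply: filterS => x [xc [_ cx]].
  by rewrite /V [in RHS]/components /lie_bracket cx.
have [_ cX] := aX; have [_ cY] := aY.
apply: mx_analytic_at_add; last apply: mx_analytic_at_opp.
  apply: mx_analytic_at_derive; first exact: analytic_components_at.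
  exact: near_analytic_components.
apply: mx_analytic_at_derive; first exact: analytic_components_at.
exact: near_analytic_components.
Qed.

(** The [i]-th component is [sum_j (d_i Y_j) theta_j + Y_j (d_j theta_i)]. *)
Definition lie_derivative Y theta : one_form M := fun p c =>
  'J (components Y c) (c p) *m theta p c + 'D_(Y p c) (components theta c) (c
    p).

(** The second derivatives of the transition map reappear here with the index
of differentiation exchanged; mixed partials make the two readings agree. *)
Lemma jacobian_vector_field_chart Y p c c' : analytic_vector_field Y ->
  charts_at p c -> charts_at p c' ->
  jac c c' p *m 'J (components Y c') (c' p)
    = 'J (components Y c) (c p) *m jac c c' p
      + 'D_(Y p c) (fun x => 'J (transition c c') x) (c p).
Proof.
move=> aY pc pc'; have [_ cY] := aY.
apply: mulmx_rV_inj => v.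
rewrite mulmxA mulmxDr mulmxA.
have DY := derive_jacobian v (analytic_components_at cY pc).
have DJ := derive_jacobianC v (Y p c) (near_transition_analytic pc pc').
have DY' := derive_jacobian (v *m jac c c' p) (analytic_components_at cY pc').
have DYJ := derive_vector_field_chart v aY pc pc'.
exact: (etrans (esym DY') (etrans DYJ
  (congr2 (fun A B => A *m jac c c' p + B) DY (esym DJ)))).
Qed.

Let lie_derivative_chart_aux (J A B D : 'M[R]_n) (t t' d d' : 'cV[R]_n) :
  J *m B = A *m J + D -> t = J *m t' -> d = D *m t' + J *m d' ->
  A *m t + d = J *m (B *m t' + d').
Proof.
by move=> JB -> ->; rewrite mulmxDr !mulmxA JB mulmxDl addrA.
Qed.

Lemma analytic_lie_derivative Y theta : analytic_vector_field Y ->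
  analytic_one_form theta -> analytic_one_form (lie_derivative Y theta).
Proof.
move=> aY aT; have [trY cY] := aY; have [trT cT] := aT.
split=> [p c c' pc pc'|].
  have Ta := transition_analytic_at pc pc'.
  have nT := near_transition_analytic pc pc'.
  have Ja := mx_analytic_at_jacobian nT.
  have aT' := mx_analytic_at_comp_transition cT pc pc'.
  have D1 : 'D_(Y p c) (components theta c' \o transition c c') (c p)
      = 'D_(Y p c') (components theta c') (c' p).
    rewrite (trY p c c' pc pc') -(transitionE c' pc).
    exact: derive_mx_comp Ta aT'.
  have D2 := derive_mulmx (mx_analytic_at_derivable (v := Y p c) Ja)
    (derivable_mx_comp (v := Y p c) Ta aT').
  have D3 := etrans (near_eq_derive (Y p c) (near_one_form aT pc pc')) D2.
  rewrite D1 /= (transitionE _ pc) (componentsE _ pc') in D3.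
  exact: lie_derivative_chart_aux (jacobian_vector_field_chart aY pc pc')
    (trT _ _ _ pc pc') D3.
apply: analytic_componentsP => p c pc.
pose V x := 'J (components Y c) x *m components theta c x
          + 'D_(components Y c x) (components theta c) x.
apply: (@near_mx_analytic_at _ _ _ _ V).
  have := near_charts_at pc pc; apply: filterS => x [xc [_ cx]].
  by rewrite /V [in RHS]/components /lie_derivative cx.
apply: mx_analytic_at_add.
  apply: mx_analytic_at_mul; last exact: analytic_components_at.
  by apply: mx_analytic_at_jacobian; exact: near_analytic_components.
apply: mx_analytic_at_derive; first exact: analytic_components_at.
exact: near_analytic_components.
Qed.

End ChartCalculus.

(** * Contractions and differentials *)

Section Pairings.
Context {R : realType} {n : nat} (M : manifold R n).
Implicit Types (p q : M) (c : chart R n M) (f h : function M)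
  (X Y : vector_field M) (theta : one_form M) (g : bilinear_field M).

Lemma analytic_function_at f p c : analytic_function f -> charts_at p c ->
  analytic_at (f \o chart_inv c) (c p).
Proof. by move=> af [cA cp]; apply: af => //; exists p. Qed.

Lemma analytic_functionP f :
  (forall p c, charts_at p c -> analytic_at (f \o chart_inv c) (c p)) ->
  analytic_function f.
Proof. by move=> af c cA _ [p cp <-]; apply: af. Qed.

Lemma analytic_function_cst (k : R) : analytic_function (cst k : function M).
Proof. by apply: analytic_functionP => p c pc; exact: analytic_at_cst. Qed.

Lemma analytic_functionD f h : analytic_function f -> analytic_function h ->
  analytic_function (f \+ h).
Proof.
move=> af ah; apply: analytic_functionP => p c pc.
exact: (analytic_atD (analytic_function_at af pc) (analytic_function_at ah pc)).
Qed.

Lemma analytic_functionM f h : analytic_function f -> analytic_function h ->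
  analytic_function (f \* h).
Proof.
move=> af ah; apply: analytic_functionP => p c pc.
exact: (analytic_atM (analytic_function_at af pc) (analytic_function_at ah pc)).
Qed.

Lemma pairingE theta X p c : analytic_one_form theta ->
  analytic_vector_field X -> charts_at p c ->
  pairing theta X p = (X p c *m theta p c) 0 0.
Proof.
move=> [trT _] [trX _] pc; have pc0 := charts_at_chart_at p.
by rewrite /pairing (trT _ _ _ pc pc0) (trX _ _ _ pc pc0) mulmxA.
Qed.

Lemma near_pairing theta X p c : analytic_one_form theta ->
  analytic_vector_field X -> charts_at p c ->
  \forall x \near c p, (pairing theta X \o chart_inv c) x
    = (components X c x *m components theta c x) 0 0.
Proof.
move=> aT aX pc; have := near_charts_at pc pc; apply: filterS => x [xc [_ cx]].
by rewrite /= (pairingE aT aX xc).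
Qed.

Lemma analytic_pairing theta X : analytic_one_form theta ->
  analytic_vector_field X -> analytic_function (pairing theta X).
Proof.
move=> aT aX; apply: analytic_functionP => p c pc.
have [_ cT] := aT; have [_ cX] := aX.
apply: (@near_analytic_at _ _
    (fun x => (components X c x *m components theta c x) 0 0)).
  by have := near_pairing aT aX pc; apply: filterS => x ->.
apply: (mx_analytic_at_mul (analytic_components_at cX pc)).
exact: (analytic_components_at cT pc).
Qed.

Lemma mul_dform f p c v : analytic_function f -> charts_at p c ->
  (v *m dform f p c) 0 0 = 'D_v (f \o chart_inv c) (c p).
Proof.
move=> af pc; rewrite derive_partials; last first.
  exact: (analytic_at_differentiable (analytic_function_at af pc)).
by rewrite mxE; apply: eq_bigr => i _; rewrite mxE.
Qed.

Lemma analytic_dform f : analytic_function f -> analytic_one_form (dform f).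
Proof.
move=> af; split=> [p c c' pc pc'|].
  apply: mulmx_rV_inj => v; rewrite mulmxA.
  suff H : (v *m dform f p c) 0 0 = (v *m jac c c' p *m dform f p c') 0 0.
    by apply/matrixP => i j; rewrite !ord1.
  rewrite !mul_dform//.
  have E : \forall x \near c p, (f \o chart_inv c) x
      = ((f \o chart_inv c') \o transition c c') x.
    have := near_charts_at pc pc'; apply: filterS => x [xc [xc' cx]].
    by rewrite /transition /= (chart_invK xc').
  have fT : analytic_at (f \o chart_inv c') (transition c c' (c p)).
    by rewrite (transitionE _ pc); exact: analytic_function_at.
  have := derive_comp v (transition_analytic_at pc pc') fT.
  by rewrite (transitionE _ pc) => <-; exact: near_eq_derive.
apply: analytic_componentsP => p c pc i j.
apply: (@near_analytic_at _ _ ('D_'e_i (f \o chart_inv c))).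
  have := near_charts_at pc pc; apply: filterS => x [xc [_ cx]].
  by rewrite /components mxE cx.
exact: (analytic_at_partial _ (analytic_function_at af pc)).
Qed.

Lemma pairing_dform f X p c : analytic_function f -> analytic_vector_field X ->
  charts_at p c ->
  pairing (dform f) X p = 'D_(X p c) (f \o chart_inv c) (c p).
Proof.
by move=> af aX pc; rewrite (pairingE (analytic_dform af) aX pc) mul_dform.
Qed.

Lemma pairing_dformD f h X : analytic_function f -> analytic_function h ->
  analytic_vector_field X ->
  pairing (dform (f \+ h)) X = pairing (dform f) X \+ pairing (dform h) X.
Proof.
move=> af ah aX; apply/funext => p; have pc := charts_at_chart_at p.
have afh := analytic_functionD af ah.
rewrite /= !(fun f af => @pairing_dform f X p _ af aX pc)//.
rewrite -deriveD//; apply: diff_derivable; apply: analytic_at_differentiable.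
  exact: analytic_function_at.
exact: analytic_function_at.
Qed.

Lemma pairing_dformM f h X : analytic_function f -> analytic_function h ->
  analytic_vector_field X ->
  pairing (dform (f \* h)) X
    = (f \* pairing (dform h) X) \+ (h \* pairing (dform f) X).
Proof.
move=> af ah aX; apply/funext => p; have pc := charts_at_chart_at p.
have afh := analytic_functionM af ah.
rewrite /= !(fun f af => @pairing_dform f X p _ af aX pc)//.
have := @deriveM _ _ (f \o chart_inv (chart_at p)) (h \o chart_inv (chart_at p))
  (chart_at p p) (X p (chart_at p)).
rewrite /GRing.scale/= (chart_invK pc) => <- //.
  apply: diff_derivable; apply: analytic_at_differentiable.
  exact: analytic_function_at.
apply: diff_derivable; apply: analytic_at_differentiable.
exact: analytic_function_at.
Qed.

Lemma pairing_dform_cst (k : R) X : analytic_vector_field X ->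
  pairing (dform (cst k)) X = cst 0.
Proof.
move=> aX; apply/funext => p; have pc := charts_at_chart_at p.
rewrite (pairing_dform (analytic_function_cst k) aX pc).
exact: derive_cst.
Qed.

(** Leibniz rule for the Lie derivative of the contraction [theta(X)]. *)
Lemma pairing_lie_derivative theta X Y : analytic_one_form theta ->
  analytic_vector_field X -> analytic_vector_field Y ->
  pairing (dform (pairing theta X)) Y
    = pairing (lie_derivative Y theta) X \+ pairing theta (lie_bracket Y X).
Proof.
move=> aT aX aY; apply/funext => p; have pc := charts_at_chart_at p.
have [_ cT] := aT; have [_ cX] := aX; have [_ cY] := aY.
have cTp := analytic_components_at cT pc.
have cXp := analytic_components_at cX pc.
have cYp := analytic_components_at cY pc.
rewrite /= (pairing_dform (analytic_pairing aT aX) aY pc).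
rewrite (pairingE (analytic_lie_derivative aY aT) aX pc).
rewrite (pairingE aT (analytic_lie_bracket aY aX) pc).
rewrite (near_eq_derive _ (near_pairing aT aX pc)).
set v := Y p _; set c := chart_at p.
have dX := mx_analytic_at_derivable (v := v) cXp.
have dT := mx_analytic_at_derivable (v := v) cTp.
have /matrixP/(_ 0 0) := derive_mx (mx_analytic_at_derivable (v := v)
  (mx_analytic_at_mul cXp cTp)).
rewrite [RHS]mxE => /esym DE; apply: etrans DE _.
rewrite (derive_mulmx dX dT) (componentsE _ pc) (componentsE _ pc).
rewrite /lie_derivative /lie_bracket -!/(components _ _).
rewrite mulmxDr mulmxBl mulmxA -(derive_jacobian _ cYp) -/c -/v !mxE.
ring.
Qed.

Definition flat g Y : one_form M := fun p c => g p c *m (Y p c)^T.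

Lemma analytic_flat g Y : analytic_symmetric_form g ->
  analytic_vector_field Y -> analytic_one_form (flat g Y).
Proof.
move=> [trg _ cg] [trY cY]; split=> [p c c' pc pc'|].
  by rewrite /flat (trg _ _ _ pc pc') (trY _ _ _ pc pc') trmx_mul !mulmxA.
apply: analytic_componentsP => p c pc.
apply: (mx_analytic_at_mul (analytic_components_at cg pc)).
exact: (mx_analytic_at_tr (analytic_components_at cY pc)).
Qed.

Lemma metric_pairing_flat g X Y :
  metric_pairing g X Y = pairing (flat g Y) X.
Proof. by apply/funext => p; rewrite /metric_pairing /pairing mulmxA. Qed.

Lemma metric_pairingC g X Y : analytic_symmetric_form g ->
  metric_pairing g X Y = metric_pairing g Y X.
Proof.
move=> [_ gT _]; apply/funext => p; rewrite /metric_pairing.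
have tr00 (A : 'M[R]_1) : A 0 0 = A^T 0 0 by rewrite mxE.
by rewrite tr00 !trmx_mul trmxK (gT _ _ (charts_at_chart_at p)) mulmxA.
Qed.

End Pairings.

(** * Extension of derivations to algebraic extensions *)

Section ExtendDerivation.
Variables (F K : fieldType) (j : {rmorphism F -> K}).

(** [d] is a derivation of [F] with values in [K], seen as an [F]-module. *)
Definition derivation_into (d : F -> K) : Prop :=
  (forall x y, d (x + y) = d x + d y) /\
  (forall x y, d (x * y) = d x * j y + j x * d y).

Variable d : F -> K.
Hypothesis der_d : derivation_into d.

Lemma derivation_into0 : d 0 = 0.
Proof.
have [dD _] := der_d; apply: (addIr (d 0)); by rewrite -dD !addr0 add0r.
Qed.

Lemma derivation_into1 : d 1 = 0.
Proof.
have [_ dM] := der_d; apply: (addIr (d 1)).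
by rewrite add0r -[in RHS](mulr1 1) dM rmorph1 mulr1 mul1r.
Qed.

Local Notation "p ^j" := (map_poly j p) (at level 2, format "p ^j").

(** The value at [p(x)] of the derivation that extends [d] and sends [x] to
[y]: differentiate the coefficients, then the variable. *)
Definition derive_at (x y : K) (p : {poly F}) : K :=
  (map_poly d p).[x] + (p^j)^`().[x] * y.

Lemma derive_atD x y p q :
  derive_at x y (p + q) = derive_at x y p + derive_at x y q.
Proof.
have [dD _] := der_d.
have mD : map_poly d (p + q) = map_poly d p + map_poly d q.
  by apply/polyP => i; rewrite coefD !coef_map_id0 ?derivation_into0// coefD dD.
by rewrite /derive_at mD rmorphD derivD !hornerD; ring.
Qed.

Lemma derive_atM x y p q : derive_at x y (p * q)
  = derive_at x y p * q^j.[x] + p^j.[x] * derive_at x y q.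
Proof.
have [dD dM] := der_d.
have mM : map_poly d (p * q) = map_poly d p * q^j + p^j * map_poly d q.
  apply/polyP => i; rewrite coef_map_id0 ?derivation_into0// coefD !coefM.
  rewrite (big_morph d dD derivation_into0) -big_split; apply: eq_bigr => k _.
  by rewrite /= dM !coef_map_id0 ?derivation_into0 ?rmorph0.
by rewrite /derive_at mM rmorphM derivM !hornerE; ring.
Qed.

Lemma derive_atC x y c : derive_at x y c%:P = d c.
Proof.
rewrite /derive_at map_polyC derivC horner0 mul0r addr0.
have -> : map_poly d c%:P = (d c)%:P.
  apply/polyP => i; rewrite coef_map_id0 ?derivation_into0// !coefC.
  by case: eqP; rewrite ?derivation_into0.
by rewrite hornerC.
Qed.

Lemma derive_atX x y : derive_at x y 'X = y.
Proof.
rewrite /derive_at map_polyX derivX hornerC mul1r.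
have -> : map_poly d 'X = 0.
  apply/polyP => i; rewrite coef_map_id0 ?derivation_into0// coefX coef0.
  by case: eqP; rewrite ?derivation_into0 ?derivation_into1.
by rewrite horner0 add0r.
Qed.

(** Both sides are derivations along [p |-> p(q(x))] that agree on constants
and on ['X]. *)
Lemma derive_at_comp x y p q :
  derive_at x y (p \Po q) = derive_at q^j.[x] (derive_at x y q) p.
Proof.
elim/poly_ind: p => [|p c IHp].
  by rewrite comp_poly0 -!polyC0 !derive_atC.
rewrite comp_polyD comp_polyM comp_polyX comp_polyC.
rewrite !derive_atD !derive_atM !derive_atC IHp derive_atX.
by rewrite map_comp_poly horner_comp map_polyX hornerX.
Qed.

(** A derivation extending [d] can take the value [y] at [x] only if it kills
every algebraic relation satisfied by [x]. *)
Definition extends_at (x y : K) : Prop :=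
  forall p, root p^j x -> derive_at x y p = 0.

Hypothesis alg : forall x : K, algebraicOver j x.
Hypothesis charF : [pchar F] =i pred0.

Lemma minimal_annihilator x : exists m : {poly F}, [/\ m != 0, root m^j x &
  forall p, root p^j x -> m %| p].
Proof.
have ex_size : exists k, `[< exists p : {poly F},
    [/\ p != 0, root p^j x & size p = k] >].
  by have [p p0 px] := alg x; exists (size p); apply/asboolP; exists p.
case: (ex_minnP ex_size) => k /asboolP[m [m0 mx mk]] min_k.
exists m; split=> // p px; rewrite /dvdp; apply/negPn/negP => r0.
have rx : root (p %% m)^j x.
  move: px; rewrite {1}(divp_eq p m) rmorphD rmorphM !rootE hornerD hornerM.
  by rewrite (rootP mx) mulr0 add0r.
have : (k <= size (modp p m))%N by apply: min_k; apply/asboolP;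
  exists (modp p m).
by rewrite leqNgt -mk ltn_modp m0.
Qed.

(** In characteristic zero a minimal annihilator has a nonzero derivative of
smaller size, which therefore cannot vanish at [x]. *)
Lemma minimal_deriv_neq0 x (m : {poly F}) : m != 0 -> root m^j x ->
  (forall p, root p^j x -> m %| p) -> (m^j)^`().[x] != 0.
Proof.
move=> m0 mx min_m; rewrite deriv_map; apply/negP => m'x.
have m_gt1 : (1 < size m)%N.
  have := root_size_gt1 _ mx; rewrite size_map_poly; apply.
  by rewrite map_poly_eq0.
have m'0 : m^`() != 0.
  have /pcharf0P char0 := charF.
  apply/eqP => /polyP/(_ (size m).-2); rewrite coef_deriv coef0 => /eqP.
  have -> : (size m).-2.+1 = (size m).-1 by case: (size m) m_gt1 => [|[]].
  rewrite -mulr_natr mulf_eq0 -lead_coefE lead_coef_eq0 (negPf m0) char0.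
  by case: (size m) m_gt1 => [|[]].
have := dvdp_leq m'0 (min_m _ m'x).
by rewrite leqNgt lt_size_deriv.
Qed.

Lemma extends_at_exists x : exists y, extends_at x y.
Proof.
have [m [m0 mx min_m]] := minimal_annihilator x.
have m'x := minimal_deriv_neq0 m0 mx min_m.
exists (- (map_poly d m).[x] / (m^j)^`().[x]) => p /min_m/dvdpP[q ->].
rewrite derive_atM (rootP mx) mulr0 add0r /derive_at [X in _ + X]mulrC.
by rewrite divfK// addrN mulr0.
Qed.

Lemma extends_at_unique x y y' : extends_at x y -> extends_at x y' -> y = y'.
Proof.
have [m [m0 mx min_m]] := minimal_annihilator x.
have m'x := minimal_deriv_neq0 m0 mx min_m.
move=> /(_ _ mx) + /(_ _ mx); rewrite /derive_at => <- /addrI/(mulfI m'x).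
by [].
Qed.

Lemma extends_at_poly x y q : extends_at x y ->
  extends_at q^j.[x] (derive_at x y q).
Proof.
move=> exy p px; rewrite -derive_at_comp; apply: exy.
by rewrite map_comp_poly rootE horner_comp.
Qed.

(** Existence and additivity rest on a primitive element: two elements of [K]
are polynomials in a common third one, on which the extension is explicit. *)
Lemma extend_derivation : exists D : K -> K,
  [/\ forall x y, D (x + y) = D x + D y,
      forall x y, D (x * y) = D x * y + x * D y &
      forall c, D (j c) = d c].
Proof.
have [D DE] := choice extends_at_exists.
have prim x y : exists z p q, x = p^j.[z] /\ y = q^j.[z].
  have [p p0 px] := alg x; have [q q0 qy] := alg y.
  have [k [[u ux] [v vy]]] := pchar0_PET p0 px q0 qy charF.
  by exists (y *+ k - x), u, v; rewrite ux vy.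
have DP z p : D p^j.[z] = derive_at z (D z) p.
  exact: extends_at_unique (DE _) (extends_at_poly (q := p) (DE z)).
exists D; split.
- move=> x y; have [z [p [q [-> ->]]]] := prim x y.
  by rewrite -hornerD -rmorphD !DP derive_atD.
- move=> x y; have [z [p [q [-> ->]]]] := prim x y.
  by rewrite -hornerM -rmorphM !DP derive_atM.
- by move=> c; have := DP 0 c%:P; rewrite map_polyC hornerC derive_atC.
Qed.

Lemma derivation_horner (D : K -> K) :
  (forall x y, D (x + y) = D x + D y) ->
  (forall x y, D (x * y) = D x * y + x * D y) ->
  (forall c, D (j c) = d c) ->
  forall x p, D p^j.[x] = derive_at x (D x) p.
Proof.
move=> DD DM Dj x; elim/poly_ind => [|p c IHp].
  by rewrite -polyC0 derive_atC map_polyC hornerC Dj.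
rewrite derive_atD derive_atM derive_atC derive_atX -IHp.
by rewrite rmorphD rmorphM /= map_polyX map_polyC !hornerE DD DM Dj.
Qed.

Lemma extend_derivation_unique (D D' : K -> K) :
  (forall x y, D (x + y) = D x + D y) ->
  (forall x y, D (x * y) = D x * y + x * D y) ->
  (forall c, D (j c) = d c) ->
  (forall x y, D' (x + y) = D' x + D' y) ->
  (forall x y, D' (x * y) = D' x * y + x * D' y) ->
  (forall c, D' (j c) = d c) -> D = D'.
Proof.
move=> DD DM Dj DD' DM' Dj'; apply/funext => x.
have D0 (E : K -> K) : (forall x y, E (x + y) = E x + E y) -> E 0 = 0.
  by move=> ED; apply: (addIr (E 0)); rewrite -ED !addr0 add0r.
apply: (@extends_at_unique x) => p /rootP px.
  by rewrite -(derivation_horner DD DM Dj) px D0.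
by rewrite -(derivation_horner DD' DM' Dj') px D0.
Qed.

End ExtendDerivation.

(** * The field of meromorphic functions *)

Section SubfieldType.
Variables (K : fieldType) (S : {pred K}) (divS : divring_closed S).

(** [S] under a name that carries its closure proof, to which the structure of
a field can be attached; the primitive element theorem is used over this
field. *)
Definition subfield_pred of divring_closed S : {pred K} := S.

HB.instance Definition _ :=
  GRing.isDivringClosed.Build K (subfield_pred divS) divS.

Record subfield_type := SubfieldType {
  subfield_val : K; _ : subfield_val \in subfield_pred divS }.

HB.instance Definition _ := [isSub for subfield_val].
HB.instance Definition _ := [Choice of subfield_type by <:].
HB.instance Definition _ := [SubChoice_isSubComUnitRing of subfield_type by <:].
HB.instance Definition _ :=
  [SubComUnitRing_isSubIntegralDomain of subfield_type by <:].
HB.instance Definition _ := [SubIntegralDomain_isSubField of subfield_type by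
  <:].

Lemma subfield_algebraic (x : K) (p : {poly K}) : p != 0 ->
  (forall i, p`_i \in S) -> root p x ->
  algebraicOver (val : subfield_type -> K) x.
Proof.
move=> p0 Sp px.
pose q := \poly_(i < size p) SubfieldType (Sp i).
have qE : map_poly val q = p.
  apply/polyP => i; rewrite coef_map coef_poly; case: ltnP => // le_pi.
  by rewrite raddf0 nth_default.
exists q; last by rewrite qE.
by apply: contraNneq p0 => q0; rewrite -qE q0 rmorph0.
Qed.

End SubfieldType.

Section AlgebroidFunctions.
Context {R : realType} {n : nat} (M : manifold R n).
Context (K : closedFieldType) (iota : function M -> K).
Hypothesis alg : algebroid_functions iota.
Implicit Types (f h : function M).

Lemma iotaD f h : analytic_function f -> analytic_function h ->
  iota (f \+ h) = iota f + iota h.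
Proof. by case: alg => + _ _ _ => /(_ f h)/[apply]/[apply] -[]. Qed.

Lemma iotaM f h : analytic_function f -> analytic_function h ->
  iota (f \* h) = iota f * iota h.
Proof. by case: alg => + _ _ _ => /(_ f h)/[apply]/[apply] -[]. Qed.

Lemma iota1 : iota (cst 1) = 1.
Proof. by case: alg. Qed.

Lemma iota_eq0 f : analytic_function f -> iota f = 0 -> f = cst 0.
Proof. by case: alg => _ _ + _; apply. Qed.

Let cstA (k : R) : analytic_function (cst k : function M) :=
  analytic_function_cst k.

Lemma iota0 : iota (cst 0) = 0.
Proof.
apply: (addIr (iota (cst 0))); rewrite add0r -iotaD; try exact: cstA.
by congr iota; apply/funext => p /=; rewrite addr0.
Qed.

Lemma iota_cstN1 : iota (cst (-1)) = -1.
Proof.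
apply: (addrI 1); rewrite addrN -[X in X + _]iota1 -iotaD; try exact: cstA.
by rewrite -iota0; congr iota; apply/funext => p /=; rewrite addrN.
Qed.

Lemma iota_inj f h : analytic_function f -> analytic_function h ->
  iota f = iota h -> f = h.
Proof.
move=> af ah fh.
have aNh : analytic_function (cst (-1) \* h) by apply: analytic_functionM.
have /iota_eq0 : analytic_function (f \+ (cst (-1) \* h)).
  exact: analytic_functionD.
rewrite iotaD// iotaM; [|exact: cstA|by []].
rewrite iota_cstN1 fh mulN1r addrN => /(_ erefl) E.
apply/funext => p; apply/eqP; rewrite -subr_eq0; apply/eqP.
by have := congr1 (@^~ p) E; rewrite /= mulN1r.
Qed.

Lemma iota_cst_nat k : iota (cst k%:R) = k%:R.
Proof.
elim: k => [|k IHk]; first exact: iota0.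
rewrite -[RHS]natr1 -[X in _ = X + _]IHk -iota1 -iotaD; try exact: cstA.
by congr iota; apply/funext => p /=; rewrite natr1.
Qed.

(** On an empty manifold the constants 0 and 1 coincide, but their images in
[K] do not. *)
Lemma manifold_point : exists p : M, True.
Proof.
apply: contrapT => noM; have /eqP := oner_neq0 K; apply.
rewrite -iota1 -iota0; congr iota; apply/funext => p.
by case: noM; exists p.
Qed.

Lemma natr_K_eq0 k : (k%:R == 0 :> K) = (k == 0)%N.
Proof.
apply/eqP/eqP => [k0|-> //]; have [p _] := manifold_point.
have := iota_eq0 (cstA k%:R); rewrite iota_cst_nat k0 => /(_ erefl).
by move=> /(congr1 (@^~ p)) /= /eqP; rewrite pnatr_eq0 => /eqP.
Qed.

Definition meromorphic_pred : {pred K} := fun x => `[< meromorphic iota x >].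

Lemma iota_neq0 f : analytic_function f -> f <> cst 0 -> iota f != 0.
Proof. by move=> af f0; apply/eqP => /(iota_eq0 af). Qed.

Lemma meromorphicP x : meromorphic iota x <-> exists f h,
  [/\ analytic_function f, analytic_function h, iota h != 0 &
      iota f = x * iota h].
Proof.
split=> -[f [h [af ah h0 xE]]]; exists f, h; split => //.
- exact: iota_neq0.
- by rewrite xE divfK// iota_neq0.
- by move=> hE; rewrite hE iota0 eqxx in h0.
- by rewrite xE mulfK.
Qed.

Lemma meromorphic_iota f : analytic_function f -> meromorphic iota (iota f).
Proof.
move=> af; apply/meromorphicP; exists f, (cst 1).
by rewrite iota1 oner_eq0 mulr1; split => //; exact: cstA.
Qed.

Lemma meromorphic_divring : divring_closed meromorphic_pred.
Proof.
split=> [|x y /asboolP/meromorphicP[f [h [af ah h0 fE]]]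
           /asboolP/meromorphicP[f' [h' [af' ah' h0' fE']]]
         |x y /asboolP/meromorphicP[f [h [af ah h0 fE]]]
           /asboolP/meromorphicP[f' [h' [af' ah' h0' fE']]]];
  apply/asboolP.
- by rewrite -iota1; apply: meromorphic_iota; exact: cstA.
- have aN : analytic_function (cst (-1) \* f') by apply: analytic_functionM.
  apply/meromorphicP; exists ((f \* h') \+ ((cst (-1) \* f') \* h)), (h \* h').
  split; [|exact: analytic_functionM|by rewrite iotaM// mulf_neq0|].
    by apply: analytic_functionD; exact: analytic_functionM.
  rewrite iotaD; [|exact: analytic_functionM|exact: analytic_functionM].
  rewrite (iotaM af ah') (iotaM aN ah) (iotaM (cstA _) af') (iotaM ah ah').
  by rewrite iota_cstN1 fE fE'; ring.
- have [y0|y0] := eqVneq y 0.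
    by rewrite y0 invr0 mulr0 -iota0; apply: meromorphic_iota; exact: cstA.
  apply/meromorphicP; exists (f \* h'), (h \* f').
  split; [exact: analytic_functionM|exact: analytic_functionM| |].
    by rewrite iotaM// fE' !mulf_neq0.
  by rewrite !iotaM// fE fE'; field.
Qed.

Definition meromorphic_field := subfield_type meromorphic_divring.

Lemma meromorphic_field_algebraic (x : K) :
  algebraicOver (val : meromorphic_field -> K) x.
Proof.
case: alg => _ _ _ /(_ x)[p [p0 pm px]].
by apply: (subfield_algebraic _ p0 _ px) => i; apply/asboolP.
Qed.

Lemma meromorphic_field_char0 : [pchar meromorphic_field] =i pred0.
Proof.
apply/pcharf0P => k; rewrite -natr_K_eq0.
by rewrite -(rmorph_nat (val : {rmorphism meromorphic_field -> K})) fmorph_eq0.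
Qed.

Section QuotientRule.
Variable delta : function M -> K.
Hypothesis deltaD : forall f h, analytic_function f -> analytic_function h ->
  delta (f \+ h) = delta f + delta h.
Hypothesis deltaM : forall f h, analytic_function f -> analytic_function h ->
  delta (f \* h) = iota f * delta h + iota h * delta f.

(** The quotient rule, for [x] a quotient [f / h]: [x * h = f] gives
[h * dx = df - x * dh]. *)
Definition quotient_rule (x y : K) : Prop := exists f h,
  [/\ analytic_function f, analytic_function h, iota h != 0,
      iota f = x * iota h & iota h * y = delta f - x * delta h].

Lemma quotient_rule_exists x : meromorphic iota x -> exists y,
  quotient_rule x y.
Proof.
move=> /meromorphicP[f [h [af ah h0 fE]]].
exists ((delta f - x * delta h) / iota h), f, h; split=> //.
by rewrite mulrC divfK.
Qed.

Lemma quotient_rule_unique x y y' :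
  quotient_rule x y -> quotient_rule x y' -> y = y'.
Proof.
move=> [f [h [af ah h0 fE yE]]] [f' [h' [af' ah' h0' fE' yE']]].
have E : f \* h' = f' \* h.
  apply: iota_inj; [exact: analytic_functionM|exact: analytic_functionM|].
  by rewrite !iotaM// fE fE'; ring.
have := congr1 delta E; rewrite !deltaM// fE fE' => E'.
apply: (mulfI h0); apply: (mulfI h0'); rewrite yE mulrCA yE'.
apply/eqP; rewrite -subr_eq0; apply/eqP.
transitivity ((x * iota h * delta h' + iota h' * delta f)
  - (x * iota h' * delta h + iota h * delta f')); first by ring.
by rewrite E' addrN.
Qed.

Lemma quotient_ruleD x x' y y' : quotient_rule x y -> quotient_rule x' y' ->
  quotient_rule (x + x') (y + y').
Proof.
move=> [f [h [af ah h0 fE yE]]] [f' [h' [af' ah' h0' fE' yE']]].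
have afh' := analytic_functionM af ah'; have af'h := analytic_functionM af' ah.
exists ((f \* h') \+ (f' \* h)), (h \* h'); split.
- exact: analytic_functionD.
- exact: analytic_functionM.
- by rewrite iotaM// mulf_neq0.
- by rewrite iotaD// !iotaM// fE fE'; ring.
rewrite deltaD// !deltaM// iotaM// fE fE'.
transitivity (iota h' * (iota h * y) + iota h * (iota h' * y')); first by ring.
by rewrite yE yE'; ring.
Qed.

Lemma quotient_ruleM x x' y y' : quotient_rule x y -> quotient_rule x' y' ->
  quotient_rule (x * x') (y * x' + x * y').
Proof.
move=> [f [h [af ah h0 fE yE]]] [f' [h' [af' ah' h0' fE' yE']]].
exists (f \* f'), (h \* h'); split.
- exact: analytic_functionM.
- exact: analytic_functionM.
- by rewrite iotaM// mulf_neq0.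
- by rewrite !iotaM// fE fE'; ring.
rewrite !deltaM// iotaM// fE fE'.
transitivity (x' * iota h' * (iota h * y) + x * iota h * (iota h' * y')).
  by ring.
by rewrite yE yE'; ring.
Qed.

Lemma delta_cst1 : delta (cst 1) = 0.
Proof.
have := @deltaM (cst 1) (cst 1) (cstA 1) (cstA 1).
have -> : cst 1 \* cst 1 = cst 1 :> function M.
  by apply/funext => p /=; rewrite mulr1.
by rewrite iota1 !mul1r => /eqP;
  rewrite -subr_eq0 opprD addNKr oppr_eq0 => /eqP.
Qed.

Lemma quotient_rule_iota f : analytic_function f ->
  quotient_rule (iota f) (delta f).
Proof.
move=> af; exists f, (cst 1); rewrite iota1 oner_eq0 mulr1 mul1r delta_cst1.
by rewrite mulr0 subr0; split => //; exact: cstA.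
Qed.

Definition extends_delta : set (K -> K) := [set D |
  [/\ forall x y, D (x + y) = D x + D y,
      forall x y, D (x * y) = D x * y + x * D y &
      forall f, analytic_function f -> D (iota f) = delta f]].

Lemma meromorphic_derivation : exists d : meromorphic_field -> K,
  derivation_into (val : meromorphic_field -> K) d /\
  (forall x, quotient_rule (val x) (d x)).
Proof.
have /choice[d dE] : forall x : meromorphic_field, exists y,
    quotient_rule (val x) y.
  by move=> x; apply: quotient_rule_exists; apply/asboolP; exact: valP x.
exists d; split=> //; split=> x y.
  by apply: (quotient_rule_unique (dE _)); rewrite rmorphD;
    exact: (quotient_ruleD (dE x) (dE y)).
by apply: (quotient_rule_unique (dE _)); rewrite rmorphM;
  exact: (quotient_ruleM (dE x) (dE y)).
Qed.

Lemma extends_delta_quotient D x : extends_delta D -> meromorphic iota x ->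
  quotient_rule x (D x).
Proof.
move=> [DD DM Df] /meromorphicP[f [h [af ah h0 fE]]]; exists f, h; split=> //.
by rewrite -(Df _ af) -(Df _ ah) fE DM; ring.
Qed.

(** The quotient rule determines the derivation on quotients of analytic
functions; it then extends along the algebraic extension [K]. *)
Lemma extends_delta_exists : exists D, extends_delta D.
Proof.
have [d [der_d dE]] := meromorphic_derivation.
have [D [DD DM Dd]] := extend_derivation der_d meromorphic_field_algebraic
  meromorphic_field_char0.
exists D; split=> // f af.
have mf : iota f \in subfield_pred meromorphic_divring.
  by apply/asboolP; exact: meromorphic_iota.
rewrite -[iota f]/(val (SubfieldType mf)) Dd.
by apply: quotient_rule_unique (dE _) _; exact: quotient_rule_iota.
Qed.

Lemma extends_delta_unique D D' : extends_delta D -> extends_delta D' -> D = D'.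
Proof.
move=> eD eD'; have [d [der_d dE]] := meromorphic_derivation.
have [DD DM _] := eD; have [DD' DM' _] := eD'.
have vE (E : K -> K) : extends_delta E -> forall c : meromorphic_field,
  E (val c) = d c.
  move=> eE c; apply: quotient_rule_unique (dE c);
    apply: extends_delta_quotient => //.
  by apply/asboolP; exact: valP c.
exact: (extend_derivation_unique der_d meromorphic_field_algebraic
  meromorphic_field_char0 DD DM (vE _ eD) DD' DM' (vE _ eD')).
Qed.

End QuotientRule.

End AlgebroidFunctions.

(** * Algebroid vector fields *)

Section AlgebroidFields.
Context {R : realType} {n : nat} (M : manifold R n).
Context (K : closedFieldType) (iota : function M -> K).
Hypothesis alg : algebroid_functions iota.
Implicit Types (f h : function M) (X Y : vector_field M) (theta : one_form M)
  (v w : Kfield M K).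

Lemma KfieldD v w theta : (v + w) theta = (v theta : K) + (w theta : K).
Proof. by []. Qed.

Lemma KfieldZ (k : K) v theta : (k *: v) theta = k * (v theta : K).
Proof. by []. Qed.

Lemma KfieldN v theta : (- v) theta = - (v theta : K).
Proof. by []. Qed.

Lemma Kfield_sum (J : Type) (s : seq J) (F : J -> Kfield M K) theta :
  (\sum_(j <- s) F j) theta = \sum_(j <- s) (F j theta : K).
Proof. by elim: s => [|j s IHs]; rewrite ?big_nil// !big_cons KfieldD IHs. Qed.

Lemma of_vector_fieldE X theta : analytic_one_form theta ->
  of_vector_field iota X theta = iota (pairing theta X).
Proof. by move=> aT; rewrite /of_vector_field asboolT. Qed.

Lemma of_vector_field_nonanalytic X theta : ~ analytic_one_form theta ->
  of_vector_field iota X theta = 0.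
Proof. by move=> aT; rewrite /of_vector_field asboolF. Qed.

Lemma combinationE m (a : 'I_m -> K) (X : 'I_m -> vector_field M) theta :
  combination iota a X theta
    = \sum_i a i * of_vector_field iota (X i) theta.
Proof. by rewrite /combination Kfield_sum. Qed.

Lemma algebroid_vf_nonanalytic v theta : algebroid_vf iota v ->
  ~ analytic_one_form theta -> v theta = 0.
Proof.
move=> [m [a [X [_ ->]]]] nT; rewrite combinationE big1// => i _.
by rewrite of_vector_field_nonanalytic// mulr0.
Qed.

Lemma algebroid_vf_ext v w : algebroid_vf iota v -> algebroid_vf iota w ->
  (forall theta, analytic_one_form theta -> v theta = w theta) -> v = w.
Proof.
move=> Vv Vw vw; apply/funext => theta.
have [aT|nT] := pselect (analytic_one_form theta); first exact: vw.
by rewrite !algebroid_vf_nonanalytic.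
Qed.

Lemma represents1 X : analytic_vector_field X ->
  represents iota (of_vector_field iota X) (fun _ : 'I_1 => 1) (fun=> X).
Proof. by move=> aX; split=> //; rewrite /combination big_ord1 scale1r. Qed.

Lemma algebroid_of_vector_field X : analytic_vector_field X ->
  algebroid_vf iota (of_vector_field iota X).
Proof. by move=> aX; exists 1%N, (fun=> 1), (fun=> X); exact: represents1. Qed.

Lemma algebroid_vf_dformD v f h : algebroid_vf iota v ->
  analytic_function f -> analytic_function h ->
  v (dform (f \+ h)) = v (dform f) + v (dform h).
Proof.
move=> [m [a [X [aX ->]]]] af ah; rewrite !combinationE -big_split.
have afh := analytic_functionD af ah; apply: eq_bigr => i _.
rewrite !of_vector_fieldE; try exact: analytic_dform.
rewrite pairing_dformD//= -mulrDr; congr (_ * _); apply: (iotaD alg).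
  by apply: analytic_pairing => //; exact: analytic_dform.
by apply: analytic_pairing => //; exact: analytic_dform.
Qed.

(** This is what makes [f |-> v (dform f)] a derivation of the analytic
functions. *)
Lemma algebroid_vf_dformM v f h : algebroid_vf iota v ->
  analytic_function f -> analytic_function h ->
  v (dform (f \* h)) = iota f * v (dform h) + iota h * v (dform f).
Proof.
move=> [m [a [X [aX ->]]]] af ah; rewrite !combinationE !mulr_sumr -big_split.
have afh := analytic_functionM af ah; apply: eq_bigr => i _.
have aP k : analytic_function k -> analytic_function (pairing (dform k) (X i)).
  by move=> ak; apply: analytic_pairing => //; exact: analytic_dform.
rewrite !of_vector_fieldE; try exact: analytic_dform.
rewrite pairing_dformM//= (iotaD alg); try by apply: analytic_functionM => //;
  exact: aP.
rewrite (iotaM alg af (aP _ ah)) (iotaM alg ah (aP _ af)); ring.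
Qed.

Lemma act_derivation v : algebroid_vf iota v ->
  derivation_along iota v (act iota v).
Proof.
move=> Vv; apply: xgetPex.
apply: (extends_delta_exists alg (delta := fun f => v (dform f))) => f h.
  exact: algebroid_vf_dformD.
exact: algebroid_vf_dformM.
Qed.

Lemma act_unique v D : algebroid_vf iota v -> derivation_along iota v D ->
  act iota v = D.
Proof.
move=> Vv vD.
apply: (extends_delta_unique alg (delta := fun f => v (dform f)) _ _
  (act_derivation Vv) vD) => f h.
  exact: algebroid_vf_dformD.
exact: algebroid_vf_dformM.
Qed.

Lemma actD v x y : algebroid_vf iota v ->
  act iota v (x + y) = act iota v x + act iota v y.
Proof. by move=> /act_derivation[]. Qed.

Lemma actM v x y : algebroid_vf iota v ->
  act iota v (x * y) = act iota v x * y + x * act iota v y.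
Proof. by move=> /act_derivation[]. Qed.

Lemma act_iota v f : algebroid_vf iota v -> analytic_function f ->
  act iota v (iota f) = v (dform f).
Proof. by move=> /act_derivation[_ _]; apply. Qed.

Lemma act0 v : algebroid_vf iota v -> act iota v 0 = 0.
Proof. by move=> Vv; apply: (addIr (act iota v 0));
  rewrite -actD// !addr0 add0r. Qed.

Lemma act_sum v (J : Type) (s : seq J) (F : J -> K) : algebroid_vf iota v ->
  act iota v (\sum_(j <- s) F j) = \sum_(j <- s) act iota v (F j).
Proof.
move=> Vv; elim: s => [|j s IHs]; first by rewrite !big_nil act0.
by rewrite !big_cons actD// IHs.
Qed.

Lemma act_combination m (a : 'I_m -> K) (X : 'I_m ->
  vector_field M) v x : represents iota v a X ->
  act iota v x = \sum_i a i * act iota (of_vector_field iota (X i)) x.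
Proof.
move=> vE; have Vv : algebroid_vf iota v by exists m, a, X.
have [aX vX] := vE.
have VX i := algebroid_of_vector_field (aX i).
rewrite (act_unique (D := fun x =>
  \sum_i a i * act iota (of_vector_field iota (X i)) x))//; split.
- move=> y z; rewrite -big_split; apply: eq_bigr => i _.
  by rewrite actD// mulrDr.
- move=> y z; rewrite mulr_suml mulr_sumr -big_split; apply: eq_bigr => i _.
  by rewrite actM//=; ring.
- move=> f af; rewrite vX combinationE; apply: eq_bigr => i _.
  by rewrite act_iota.
Qed.

Lemma act_cst v (k : R) : algebroid_vf iota v -> act iota v (iota (cst k)) = 0.
Proof.
move=> Vv; have aC := analytic_function_cst (M := M) k; rewrite act_iota//.
have [m [a [X [aX ->]]]] := Vv; rewrite combinationE big1// => i _.
rewrite of_vector_fieldE; last exact: analytic_dform.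
by rewrite pairing_dform_cst// (iota0 alg) mulr0.
Qed.

Section Determinants.

Lemma analytic_function_sum (J : Type) (s : seq J) (F : J -> function M) :
  (forall j, analytic_function (F j)) ->
  analytic_function (fun p => \sum_(j <- s) F j p) /\
  iota (fun p => \sum_(j <- s) F j p) = \sum_(j <- s) iota (F j).
Proof.
move=> aF; elim: s => [|j s [aS IHs]].
  have -> : (fun p : M => \sum_(j <- [::]) F j p) = cst 0.
    by apply/funext => p; rewrite big_nil.
  by rewrite big_nil (iota0 alg); split => //; exact: analytic_function_cst.
have -> : (fun p : M => \sum_(j <- j :: s) F j p)
    = F j \+ (fun p => \sum_(j <- s) F j p).
  by apply/funext => p; rewrite big_cons.
by rewrite big_cons (iotaD alg)// IHs; split => //; exact: analytic_functionD.
Qed.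

Lemma analytic_function_prod (J : Type) (s : seq J) (F : J -> function M) :
  (forall j, analytic_function (F j)) ->
  analytic_function (fun p => \prod_(j <- s) F j p) /\
  iota (fun p => \prod_(j <- s) F j p) = \prod_(j <- s) iota (F j).
Proof.
move=> aF; elim: s => [|j s [aS IHs]].
  have -> : (fun p : M => \prod_(j <- [::]) F j p) = cst 1.
    by apply/funext => p; rewrite big_nil.
  by rewrite big_nil (iota1 alg); split => //; exact: analytic_function_cst.
have -> : (fun p : M => \prod_(j <- j :: s) F j p)
    = F j \* (fun p => \prod_(j <- s) F j p).
  by apply/funext => p; rewrite big_cons.
by rewrite big_cons (iotaM alg)// IHs; split => //; exact: analytic_functionM.
Qed.

Lemma iota_sign (b : bool) : iota (cst ((-1) ^+ b)) = (-1) ^+ b.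
Proof. by case: b; rewrite ?expr1 ?expr0 ?(iota1 alg) ?(iota_cstN1 alg). Qed.

Lemma analytic_function_det r (F : 'I_r -> 'I_r -> function M) :
  (forall i j, analytic_function (F i j)) ->
  analytic_function (fun p => \det (\matrix_(i, j) F i j p)) /\
  iota (fun p => \det (\matrix_(i, j) F i j p))
    = \det (\matrix_(i, j) iota (F i j)).
Proof.
move=> aF; pose P (s : 'S_r) : function M := fun p => \prod_i F i (s i) p.
have PE s : analytic_function (P s) /\ iota (P s) = \prod_i iota (F i (s i)).
  exact: analytic_function_prod.
have aC (b : bool) := analytic_function_cst (M := M) ((-1) ^+ b : R).
have aT (s : 'S_r) : analytic_function (cst ((-1) ^+ s) \* P s).
  by apply: analytic_functionM => //; exact: (PE s).1.
have -> : (fun p => \det (\matrix_(i, j) F i j p))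
    = (fun p => \sum_(s : 'S_r) (cst ((-1) ^+ s) \* P s) p).
  apply/funext => p; apply: eq_bigr => s _; congr (_ * _).
  by apply: eq_bigr => i _; rewrite mxE.
have [aS ->] := analytic_function_sum (index_enum _) aT; split => //.
apply: eq_bigr => s _; rewrite (iotaM alg (aC s) (PE s).1) iota_sign (PE s).2.
by congr (_ * _); apply: eq_bigr => i _; rewrite mxE.
Qed.

Lemma det_iota_neq0 r (F : 'I_r -> 'I_r -> function M) :
  (forall i j, analytic_function (F i j)) ->
  \det (\matrix_(i, j) iota (F i j)) != 0 <->
  exists p, \det (\matrix_(i, j) F i j p) != 0.
Proof.
move=> aF; have [aD <-] := analytic_function_det aF; split.
  move=> D0; apply: contrapT => noP; have /eqP := D0; apply.
  rewrite -(iota0 alg); congr iota; apply/funext => p;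
    apply/eqP/negPn/negP => Dp.
  by apply: noP; exists p.
move=> [p Dp]; apply: contra Dp => /eqP/(iota_eq0 alg aD).
by move=> /(congr1 (@^~ p)) /= ->.
Qed.

End Determinants.

(** A family of vector fields that is linearly independent over the algebroid
functions, as witnessed by a dual family of one-forms. *)
Definition independent_fields r (e : 'I_r -> vector_field M)
    (theta : 'I_r -> one_form M) : Prop :=
  [/\ forall i, analytic_vector_field (e i),
      forall i, analytic_one_form (theta i) &
      \det (\matrix_(i, j) iota (pairing (theta j) (e i))) != 0].

Definition field_matrix r (e : 'I_r -> vector_field M) (p : M)
    (c : chart R n M) : 'M[R]_(r, n) :=
  \matrix_i e i p c.

(** The matrix of contractions factors through the components of the fields,
so its invertibility makes those linearly independent at [p]. *)
Lemma field_matrix_row_free r (e : 'I_r -> vector_field M)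
    (theta : 'I_r -> one_form M) p c :
  (forall i, analytic_vector_field (e i)) ->
  (forall i, analytic_one_form (theta i)) -> charts_at p c ->
  \det (\matrix_(i, j) pairing (theta j) (e i) p) != 0 ->
  row_free (field_matrix e p c).
Proof.
move=> aE aT pc D0.
pose B : 'M[R]_(n, r) := \matrix_(k, j) theta j p c k 0.
have AB : \matrix_(i, j) pairing (theta j) (e i) p = field_matrix e p c *m B.
  apply/matrixP => i j; rewrite !mxE (pairingE (aT j) (aE i) pc) mxE.
  by apply: eq_bigr => k _; rewrite !mxE.
rewrite AB -unitfE in D0.
have uAB : field_matrix e p c *m B \in unitmx by [].
by apply/row_freeP; exists (B *m invmx (field_matrix e p c *m B));
  rewrite mulmxA mulmxV.
Qed.

Lemma independent_fields_le r (e : 'I_r -> vector_field M)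
    (theta : 'I_r -> one_form M) :
  independent_fields e theta -> (r <= n)%N.
Proof.
move=> [aE aT]; rewrite (det_iota_neq0 (F :=
  fun i j => pairing (theta j) (e i))).
  move=> [p Dp]; have := field_matrix_row_free aE aT (charts_at_chart_at p) Dp.
  by rewrite /row_free => /eqP <-; exact: rank_leq_col.
by move=> i j; exact: analytic_pairing.
Qed.

(** Bordering the invertible matrix of contractions with one more field and
one more form yields, by maximality, a singular matrix. Its Schur complement
vanishes, which expresses the new field with coefficients that do not depend
on the new form. *)
Lemma independent_spans r (e : 'I_r -> vector_field M)
    (theta : 'I_r -> one_form M) :
  independent_fields e theta ->
  (forall (e' : 'I_r.+1 -> vector_field M)
     (theta' : 'I_r.+1 -> one_form M), ~ independent_fields e' theta') ->
  forall X, analytic_vector_field X ->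
    exists a, of_vector_field iota X = combination iota a e.
Proof.
move=> [aE aT D0] maxe X aX.
set G := \matrix_(i, j) _ in D0;
  have uG : G \in unitmx by rewrite unitmxE unitfE.
(* Row and column of the bordered matrix, whose corner is [s]. *)
pose w : 'rV[K]_r := \row_j iota (pairing (theta j) X).
exists (fun i => (w *m invmx G) 0 i).
apply: algebroid_vf_ext; first exact: algebroid_of_vector_field.
  by exists r, (fun i => (w *m invmx G) 0 i), e.
move=> t at_; rewrite combinationE of_vector_fieldE//.
pose u : 'cV[K]_r := \col_i iota (pairing t (e i)).
pose s : 'M[K]_1 := (iota (pairing t X))%:M.
suff sE : s = w *m invmx G *m u.
  have /matrixP/(_ 0 0) := sE; rewrite mxE eqxx mulr1n => ->.
  by rewrite mxE; apply: eq_bigr => i _; rewrite of_vector_fieldE// [u _ _]mxE.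
pose e' (i : 'I_(1 + r)) := if fintype.split i is inr k then e k else X.
pose t' (i : 'I_(1 + r)) := if fintype.split i is inr k then theta k else t.
have NE : \matrix_(i, j) iota (pairing (t' j) (e' i)) = block_mx s w u G.
  apply/matrixP => i j; rewrite mxE [RHS]mxE /e' /t'.
  case: (fintype.split i) => k; rewrite [RHS]mxE.
    by case: (fintype.split j) => l; rewrite [RHS]mxE ?ord1.
  by case: (fintype.split j) => l; rewrite [RHS]mxE.
have N0 : \det (block_mx s w u G) = 0.
  apply/eqP/negPn/negP => N0; apply: (maxe e' t'); split.
  - by move=> i; rewrite /e'; case: splitP.
  - by move=> i; rewrite /t'; case: splitP.
  - by rewrite NE.
(* Column elimination of [u] leaves the Schur complement. *)
have := det_mulmx (block_mx s w u G) (block_mx 1%:M 0 (- (invmx G *m u)) 1%:M).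
rewrite N0 mul0r mulmx_block !mulmx1 !mulmx0 !add0r !mulmxN mulKVmx//.
rewrite addrN det_ublock => /eqP; rewrite mulf_eq0 (negPf D0) orbF.
by rewrite det_mx11 mulmxA => /eqP E; apply/eqP;
  rewrite -subr_eq0 [X in X == 0]mx11_scalar E raddf0.
Qed.

(** An independent family has at most [n] members, so a maximal one exists.
The bound is read at a single point, where the contractions form a matrix of
rank at most [n]. *)
Lemma exists_basis : exists r (e : 'I_r -> vector_field M) (theta : 'I_r ->
  one_form M),
  independent_fields e theta /\
  forall X, analytic_vector_field X ->
    exists a, of_vector_field iota X = combination iota a e.
Proof.
pose P r := `[< exists (e : 'I_r -> vector_field M) (theta : 'I_r ->
  one_form M),
    independent_fields e theta >].
have exP : exists r, P r.
  exists 0%N; apply/asboolP; have noI : 'I_0 -> False by case.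
  exists (fun i => False_rect _ (noI i)), (fun i => False_rect _ (noI i)).
  by split; [case|case|rewrite det_mx00 oner_neq0].
have leP r : P r -> (r <= n)%N.
  by move=> /asboolP[e [theta /independent_fields_le]].
case: (ex_maxnP exP leP) => r /asboolP[e [theta eT]] max_r.
exists r, e, theta; split => //; apply: independent_spans eT _ => e' theta' eT'.
by have /max_r : P r.+1; [apply/asboolP; exists e', theta'|rewrite ltnn].
Qed.

End AlgebroidFields.

(** * Inner product and bracket of algebroid vector fields *)

Section InnerAndBracket.
Context {R : realType} {n : nat} (M : manifold R n).
Context (K : closedFieldType) (iota : function M -> K).
Hypothesis alg : algebroid_functions iota.
Implicit Types (f h : function M) (theta : one_form M) (v w : Kfield M K).

Let V := algebroid_vf iota.
Let E (X : vector_field M) : Kfield M K := of_vector_field iota X.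

Lemma combination_linear r (e : 'I_r -> vector_field M) (k : K) (a b : 'I_r ->
  K) :
  k *: combination iota a e + combination iota b e
    = combination iota (fun i => k * a i + b i) e.
Proof.
rewrite /combination scaler_sumr -big_split; apply: eq_bigr => i _.
by rewrite /= scalerDl scalerA.
Qed.

Lemma algebroid_vf_spanned : exists r (e : 'I_r -> vector_field M)
    (theta : 'I_r -> one_form M), independent_fields iota e theta /\
  forall v, V v -> exists a, v = combination iota a e.
Proof.
have [r [e [theta [eT eS]]]] := exists_basis alg.
exists r, e, theta; split=> // _ [m [a [X [aX ->]]]].
have /choice[c cE] : forall i, exists c, E (X i) = combination iota c e.
  by move=> i; exact: eS.
exists (fun k => \sum_i a i * c i k).
rewrite /combination; under eq_bigr => i _ do rewrite [of_vector_field _ _]cE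
  /combination scaler_sumr.
rewrite exchange_big/=; apply: eq_bigr => k _; rewrite scaler_suml.
by apply: eq_bigr => i _; rewrite scalerA.
Qed.

Lemma algebroid_vf_linear (k : K) v w : V v -> V w -> V (k *: v + w).
Proof.
have [r [e [theta [[aE _ _] eS]]]] := algebroid_vf_spanned.
move=> /eS[a ->] /eS[b ->]; rewrite combination_linear.
by exists r, (fun i => k * a i + b i), e.
Qed.

Lemma algebroid_vf0 : V 0.
Proof.
have noI : 'I_0 -> False by case.
exists 0%N, (fun=> 0), (fun i => False_rect _ (noI i)); split; first by case.
by rewrite /combination big_ord0.
Qed.

Lemma algebroid_vfZ (k : K) v : V v -> V (k *: v).
Proof. by move=> Vv; rewrite -[_ *: _]addr0;
  exact: algebroid_vf_linear algebroid_vf0. Qed.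

Lemma algebroid_vfD v w : V v -> V w -> V (v + w).
Proof. by move=> Vv Vw; rewrite -[v]scale1r; exact: algebroid_vf_linear. Qed.

Lemma algebroid_vfN v : V v -> V (- v).
Proof. by move=> Vv; rewrite -scaleN1r; exact: algebroid_vfZ. Qed.

Lemma algebroid_vf_sum (J : Type) (s : seq J) (F : J -> Kfield M K) :
  (forall j, V (F j)) -> V (\sum_(j <- s) F j).
Proof.
move=> VF; elim: s => [|j s IHs]; first by rewrite big_nil;
  exact: algebroid_vf0.
by rewrite big_cons; exact: algebroid_vfD.
Qed.

Section Inner.
Variable g : bilinear_field M.
Hypothesis sym_g : analytic_symmetric_form g.

Definition inner_value m (a : 'I_m -> K) (X : 'I_m -> vector_field M)
    m' (b : 'I_m' -> K) (Y : 'I_m' -> vector_field M) : K :=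
  \sum_i \sum_j a i * b j * iota (metric_pairing g (X i) (Y j)).

Lemma inner_value_flat v m (a : 'I_m -> K) X m' (b : 'I_m' -> K) Y :
  represents iota v a X -> (forall j, analytic_vector_field (Y j)) ->
  inner_value a X b Y = \sum_j b j * (v (flat g (Y j)) : K).
Proof.
move=> [aX ->] aY; rewrite /inner_value exchange_big; apply: eq_bigr => j _.
rewrite combinationE mulr_sumr; apply: eq_bigr => i _.
rewrite of_vector_fieldE; last exact: analytic_flat.
by rewrite metric_pairing_flat; ring.
Qed.

Lemma inner_valueC m (a : 'I_m -> K) X m' (b : 'I_m' -> K) Y :
  inner_value a X b Y = inner_value b Y a X.
Proof.
rewrite /inner_value exchange_big; apply: eq_bigr => j _; apply: eq_bigr => i _.
by rewrite (metric_pairingC _ _ sym_g) [b j * _]mulrC.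
Qed.

(** Contracting with the one-forms [flat g (Y j)] shows that the value depends
on the first argument only through the functional it represents; symmetry
gives the same for the second. *)
Lemma innerE v w m (a : 'I_m -> K) X m' (b : 'I_m' -> K) Y :
  represents iota v a X -> represents iota w b Y ->
  inner iota g v w = inner_value a X b Y.
Proof.
move=> vE wE; rewrite /inner.
set P := [set x | _]; have : P (xget 0 P).
  by apply: xgetPex; exists (inner_value a X b Y), m, a, X, m', b, Y.
move=> [m1 [a1 [X1 [m2 [b1 [Y1 [vE1 wE1 ->]]]]]]].
have [aX _] := vE; have [aY _] := wE; have [aX1 _] := vE1; have [aY1 _] := wE1.
rewrite -/(inner_value a1 X1 b1 Y1) (inner_value_flat _ vE1 aY1).
rewrite -(inner_value_flat _ vE aY1) inner_valueC (inner_value_flat _ wE1 aX).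
by rewrite -(inner_value_flat _ wE aX) inner_valueC.
Qed.

Lemma inner_flat v w m (b : 'I_m -> K) Y : V v -> represents iota w b Y ->
  inner iota g v w = \sum_j b j * (v (flat g (Y j)) : K).
Proof.
move=> [k [a [X vE]]] wE; rewrite (innerE vE wE) (inner_value_flat _ vE)//.
by case: wE.
Qed.

Lemma inner_linearl k v v' w : V v -> V v' -> V w ->
  inner iota g (k *: v + v') w = k * inner iota g v w + inner iota g v' w.
Proof.
move=> Vv Vv' [m [b [Y wE]]].
rewrite !(inner_flat _ wE)//; last exact: algebroid_vf_linear.
rewrite mulr_sumr -big_split; apply: eq_bigr => j _.
by rewrite KfieldD KfieldZ /=; ring.
Qed.

Lemma innerC v w : V v -> V w -> inner iota g v w = inner iota g w v.
Proof.
move=> [m [a [X vE]]] [m' [b [Y wE]]].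
by rewrite (innerE vE wE) (innerE wE vE) inner_valueC.
Qed.

End Inner.

Definition bracket_value m (a : 'I_m -> K) (X : 'I_m -> vector_field M)
    m' (b : 'I_m' -> K) (Y : 'I_m' -> vector_field M) : Kfield M K :=
  \sum_i \sum_j ((a i * act iota (E (X i)) (b j)) *: E (Y j)
    - (b j * act iota (E (Y j)) (a i)) *: E (X i)
    + (a i * b j) *: E (lie_bracket (X i) (Y j))).

Lemma algebroid_bracket_value m (a : 'I_m -> K) X m' (b : 'I_m' -> K) Y :
  (forall i, analytic_vector_field (X i)) ->
  (forall j, analytic_vector_field (Y j)) -> V (bracket_value a X b Y).
Proof.
move=> aX aY; have VE Z (aZ : analytic_vector_field Z) : V (E Z).
  exact: algebroid_of_vector_field.
apply: algebroid_vf_sum => i; apply: algebroid_vf_sum => j.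
apply: algebroid_vfD; last first.
  by apply: algebroid_vfZ; apply: VE; exact: analytic_lie_bracket.
apply: algebroid_vfD; first by apply: algebroid_vfZ; exact: VE.
by apply: algebroid_vfN; apply: algebroid_vfZ; exact: VE.
Qed.

Lemma lie_bracketN X Y : lie_bracket Y X = - lie_bracket X Y :> vector_field M.
Proof. by apply/funext => p; apply/funext => c;
  rewrite /lie_bracket !fctE opprB. Qed.

Lemma of_lie_bracketN X Y : analytic_vector_field X ->
  analytic_vector_field Y ->
  E (lie_bracket Y X) = - E (lie_bracket X Y).
Proof.
move=> aX aY; have aXY := analytic_lie_bracket aX aY.
have aYX := analytic_lie_bracket aY aX.
apply: (algebroid_vf_ext (iota := iota)).
- exact: algebroid_of_vector_field.
- by apply: algebroid_vfN; exact: algebroid_of_vector_field.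
move=> theta aT; apply/eqP; rewrite -addr_eq0; apply/eqP.
rewrite /E !of_vector_fieldE//.
rewrite -(iotaD alg); try exact: analytic_pairing.
rewrite -(iota0 alg); congr iota; apply/funext => p /=.
by rewrite /pairing lie_bracketN !fctE mulNmx mxE addNr.
Qed.

Lemma bracket_valueN m (a : 'I_m -> K) X m' (b : 'I_m' -> K) Y :
  (forall i, analytic_vector_field (X i)) ->
  (forall j, analytic_vector_field (Y j)) ->
  bracket_value b Y a X = - bracket_value a X b Y.
Proof.
move=> aX aY; rewrite /bracket_value exchange_big -sumrN; apply: eq_bigr => i _.
rewrite -sumrN; apply: eq_bigr => j _.
by rewrite of_lie_bracketN// scalerN [b j * a i]mulrC !opprD opprK addrC [- _ +
  _]addrC addrC.
Qed.

(** By the Leibniz rule for the Lie derivative the bracket of [sum a_i X_i]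
with [w] is a functional built from [w] alone. *)
Lemma bracket_valueE w m (a : 'I_m -> K) X m' (b : 'I_m' -> K) Y theta :
  (forall i, analytic_vector_field (X i)) -> represents iota w b Y ->
  analytic_one_form theta ->
  bracket_value a X b Y theta
    = \sum_i (a i * (act iota (E (X i)) (w theta)
                      - (w (lie_derivative (X i) theta) : K))
              - act iota w (a i) * (E (X i) theta : K)).
Proof.
move=> aX wE aT; have [aY wS] := wE.
rewrite /bracket_value Kfield_sum; apply: eq_bigr => i _; rewrite Kfield_sum.
have VX : V (E (X i)) by exact: algebroid_of_vector_field.
have aL := analytic_lie_derivative (aX i) aT.
rewrite (act_combination alg (a i) wE) wS !combinationE (act_sum alg)//.
rewrite mulrBr !mulr_sumr mulr_suml -!sumrB; apply: eq_bigr => j _.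
rewrite !KfieldD !KfieldZ KfieldN KfieldZ.
rewrite (actM alg)// /E !of_vector_fieldE//.
have aP := analytic_pairing aT (aY j).
rewrite (act_iota alg)// of_vector_fieldE; last exact: analytic_dform.
rewrite pairing_lie_derivative// (iotaD alg); last 2 first.
  exact: analytic_pairing.
  by apply: analytic_pairing => //; exact: analytic_lie_bracket.
by ring.
Qed.

(** [bracket_valueE] gives independence of the representation of the second
argument, and antisymmetry that of the first. *)
Lemma bracketE v w m (a : 'I_m -> K) X m' (b : 'I_m' -> K) Y :
  represents iota v a X -> represents iota w b Y ->
  bracket iota v w = bracket_value a X b Y.
Proof.
move=> vE wE; rewrite /bracket.
set P := [set u | _]; have : P (xget 0 P).
  by apply: xgetPex; exists (bracket_value a X b Y), m, a, X, m', b, Y.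
move=> [m1 [a1 [X1 [m2 [b1 [Y1 [vE1 wE1 ->]]]]]]].
rewrite -/(bracket_value a1 X1 b1 Y1).
have [aX _] := vE; have [aY _] := wE; have [aX1 _] := vE1; have [aY1 _] := wE1.
transitivity (bracket_value a1 X1 b Y).
  apply: (algebroid_vf_ext (iota := iota)); try exact: algebroid_bracket_value.
  by move=> theta aT; rewrite (bracket_valueE _ aX1 wE1 aT) (bracket_valueE _
    aX1 wE aT).
rewrite (bracket_valueN b a1 aY aX1) (bracket_valueN b a aY aX); congr (- _).
apply: (algebroid_vf_ext (iota := iota)); try exact: algebroid_bracket_value.
by move=> theta aT; rewrite (bracket_valueE _ aY vE1 aT) (bracket_valueE _ aY
  vE aT).
Qed.

Lemma algebroid_bracket v w : V v -> V w -> V (bracket iota v w).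
Proof.
move=> [m [a [X vE]]] [m' [b [Y wE]]]; rewrite (bracketE vE wE).
have [aX _] := vE; have [aY _] := wE; exact: algebroid_bracket_value.
Qed.

Lemma bracketC v w : V v -> V w -> bracket iota w v = - bracket iota v w.
Proof.
move=> [m [a [X vE]]] [m' [b [Y wE]]];
  rewrite (bracketE vE wE) (bracketE wE vE).
by have [aX _] := vE; have [aY _] := wE; exact: bracket_valueN.
Qed.

Lemma bracket_functional v w m (a : 'I_m ->
  K) X theta : represents iota v a X ->
  V w -> analytic_one_form theta ->
  bracket iota v w theta
    = \sum_i (a i * (act iota (E (X i)) (w theta)
                      - (w (lie_derivative (X i) theta) : K))
              - act iota w (a i) * (E (X i) theta : K)).
Proof.
move=> vE [m' [b [Y wE]]] aT; rewrite (bracketE vE wE).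
by have [aX _] := vE; exact: bracket_valueE.
Qed.

Lemma act_linear (k : K) v w x : V v -> V w ->
  act iota (k *: v + w) x = k * act iota v x + act iota w x.
Proof.
move=> Vv Vw; have Vkvw := algebroid_vf_linear k Vv Vw.
rewrite (act_unique alg (D := fun x => k * act iota v x + act iota w x))//.
split.
- by move=> y z; rewrite !(actD alg)//; ring.
- by move=> y z; rewrite !(actM alg)//; ring.
- by move=> f af; rewrite !(act_iota alg).
Qed.

Lemma bracketDr v w w' : V v -> V w -> V w' ->
  bracket iota v (w + w') = bracket iota v w + bracket iota v w'.
Proof.
move=> Vv Vw Vw'; have [m [a [X vE]]] := Vv; have Vww' := algebroid_vfD Vw Vw'.
apply: (algebroid_vf_ext (iota := iota)); first exact: algebroid_bracket.
  by apply: algebroid_vfD; exact: algebroid_bracket.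
move=> theta aT; rewrite KfieldD !(bracket_functional vE)// -big_split.
have [aX _] := vE; apply: eq_bigr => i _.
have VX : V (E (X i)) by exact: algebroid_of_vector_field.
have actww' := act_linear 1 (a i) Vw Vw'.
rewrite scale1r mul1r in actww'.
by rewrite !KfieldD (actD alg)// actww' /=; ring.
Qed.

Lemma bracketZr (k : K) v w : V v -> V w ->
  bracket iota v (k *: w) = k *: bracket iota v w + act iota v k *: w.
Proof.
move=> Vv Vw; have [m [a [X vE]]] := Vv; have Vkw := algebroid_vfZ k Vw.
have Vbr := algebroid_bracket Vv Vw.
apply: (algebroid_vf_ext (iota := iota)); first exact: algebroid_bracket.
  by apply: algebroid_vf_linear => //; exact: algebroid_vfZ.
move=> theta aT; rewrite KfieldD !KfieldZ !(bracket_functional vE)//.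
rewrite (act_combination alg k vE) mulr_sumr mulr_suml -big_split.
have [aX _] := vE; apply: eq_bigr => i _.
have VX : V (E (X i)) by exact: algebroid_of_vector_field.
have actkw := act_linear k (a i) Vw algebroid_vf0.
rewrite addr0 in actkw.
have act00 : act iota 0 (a i) = 0.
  have := act_linear 1 (a i) algebroid_vf0 algebroid_vf0.
  by rewrite scale1r mul1r addr0 => /eqP;
    rewrite -subr_eq0 opprD addNKr oppr_eq0 => /eqP.
by rewrite !KfieldZ (actM alg)// actkw act00 /=; ring.
Qed.

End InnerAndBracket.

(** * The Levi-Civita connection of a Lie-Rinehart module *)

Section LeviCivita.
Variables (K : fieldType) (E : lmodType K) (V : set E).
Variables (act : E -> K -> K) (ip : E -> E -> K) (br : E -> E -> E).
Implicit Types (u v w X Y Z : E) (k : K).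

Hypothesis two_neq0 : 2%:R != 0 :> K.
Hypothesis V0 : V 0.
Hypothesis Vlin : forall k u v, V u -> V v -> V (k *: u + v).
Hypothesis act_linl : forall k u v x, V u -> V v ->
  act (k *: u + v) x = k * act u x + act v x.
Hypothesis act_add : forall u x y, V u -> act u (x + y) = act u x + act u y.
Hypothesis act_mul : forall u x y, V u ->
  act u (x * y) = act u x * y + x * act u y.
Hypothesis ip_linl : forall k u v w, V u -> V v -> V w ->
  ip (k *: u + v) w = k * ip u w + ip v w.
Hypothesis ip_sym : forall u v, V u -> V v -> ip u v = ip v u.
Hypothesis Vbr : forall u v, V u -> V v -> V (br u v).
Hypothesis br_anti : forall u v, V u -> V v -> br v u = - br u v.
Hypothesis br_addr : forall u v w, V u -> V v -> V w ->
  br u (v + w) = br u v + br u w.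
Hypothesis br_scaler : forall k u v, V u -> V v ->
  br u (k *: v) = k *: br u v + act u k *: v.

Variables (r : nat) (e : 'I_r -> E).
Hypothesis Ve : forall i, V (e i).
Hypothesis spanned : forall v, V v -> exists a : 'I_r -> K,
  v = \sum_i a i *: e i.
Hypothesis nondegenerate : forall v, V v -> (forall i, ip v (e i) = 0) -> v = 0.
Hypothesis riesz : forall phi : 'I_r -> K,
  exists v, V v /\ forall i, ip v (e i) = phi i.

Let VZ k u : V u -> V (k *: u).
Proof. by move=> Vu; rewrite -[k *: u]addr0; exact: Vlin. Qed.

Let VD u v : V u -> V v -> V (u + v).
Proof. by move=> Vu Vv; rewrite -[u]scale1r; exact: Vlin. Qed.

Let VN u : V u -> V (- u).
Proof. by move=> Vu; rewrite -scaleN1r; exact: VZ. Qed.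

Let Vsum (J : Type) (s : seq J) (F : J -> E) :
  (forall j, V (F j)) -> V (\sum_(j <- s) F j).
Proof.
by move=> VF; elim: s => [|j s IHs]; rewrite ?big_nil// big_cons; exact: VD.
Qed.

Lemma linear_on_spanned (T : lmodType K) (F G : E -> T) :
  (forall k u v, V u -> V v -> F (k *: u + v) = k *: F u + F v) ->
  (forall k u v, V u -> V v -> G (k *: u + v) = k *: G u + G v) ->
  (forall i, F (e i) = G (e i)) -> forall v, V v -> F v = G v.
Proof.
move=> FL GL FG _ /spanned[a ->].
have F0 (H : E -> T) : (forall k u v, V u -> V v ->
    H (k *: u + v) = k *: H u + H v) -> H 0 = 0.
  move=> HL; apply: (addIr (H 0)); rewrite add0r -[X in X + _]scale1r -HL//.
  by rewrite scale1r addr0.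
elim: (index_enum _) => [|i s IHs]; first by rewrite !big_nil !F0.
have Vs : V (\sum_(j <- s) a j *: e j) by apply: Vsum => j; exact: VZ.
by rewrite !big_cons FL// GL// IHs FG.
Qed.

Let ip_linr k u v w : V u -> V v -> V w ->
  ip w (k *: u + v) = k * ip w u + ip w v.
Proof.
move=> Vu Vv Vw; rewrite ip_sym//; last exact: Vlin.
by rewrite ip_linl// (ip_sym Vu)// (ip_sym Vv).
Qed.

Let ipZl k u w : V u -> V w -> ip (k *: u) w = k * ip u w.
Proof.
move=> Vu Vw; have ip0 : ip 0 w = 0.
  apply: (addIr (ip 0 w)); rewrite add0r -[X in X + _]mul1r -ip_linl//.
  by rewrite scale1r addr0.
by rewrite -[k *: u]addr0 ip_linl// ip0 addr0.
Qed.

Let ipDl u v w : V u -> V v -> V w -> ip (u + v) w = ip u w + ip v w.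
Proof. by move=> Vu Vv Vw; rewrite -[u]scale1r ip_linl// scale1r mul1r. Qed.

Let ipNl u w : V u -> V w -> ip (- u) w = - ip u w.
Proof. by move=> Vu Vw; rewrite -scaleN1r ipZl// mulN1r. Qed.

Let ip_brl k u v w : V u -> V v -> V w -> forall z, V z ->
  ip (br z (k *: u + v)) w = k * ip (br z u) w + act z k * ip u w + ip (br z v)
    w.
Proof.
move=> Vu Vv Vw z Vz; have Vku := VZ k Vu; have Vbu := Vbr Vz Vu.
have Vbv := Vbr Vz Vv; have Vkb := VZ k Vbu; have Vau := VZ (act z k) Vu.
have Vs := VD Vkb Vau.
by rewrite br_addr// br_scaler// !ipDl// !ipZl.
Qed.

Let ip_brr k u v w : V u -> V v -> V w -> forall z, V z ->
  ip (br (k *: u + v) z) w = k * ip (br u z) w - act z k * ip u w + ip (br v z)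
    w.
Proof.
move=> Vu Vv Vw z Vz; have Vkuv := Vlin k Vu Vv.
rewrite (br_anti Vz Vkuv) (br_anti Vz Vu) (br_anti Vz Vv).
have VA := Vbr Vz Vkuv; have VB := Vbr Vz Vu; have VC := Vbr Vz Vv.
by rewrite !ipNl// ip_brl//; ring.
Qed.

Let ip_inj u v : V u -> V v -> (forall Z, V Z -> ip u Z = ip v Z) -> u = v.
Proof.
move=> Vu Vv uv; apply/eqP; rewrite -subr_eq0; apply/eqP.
have VNv := VN Vv; apply: nondegenerate; first exact: VD.
by move=> i; rewrite ipDl// ipNl// uv// subrr.
Qed.

(** Twice the inner product of [nabla X Y] with [Z], by the classical formula.
*)
Definition koszul X Y Z : K :=
  act X (ip Y Z) + act Y (ip X Z) - act Z (ip X Y)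
  + ip (br X Y) Z - ip (br X Z) Y - ip (br Y Z) X.

Lemma koszul_lin1 k X X' Y Z : V X -> V X' -> V Y -> V Z ->
  koszul (k *: X + X') Y Z = k * koszul X Y Z + koszul X' Y Z.
Proof.
move=> VX VX' VY VZ'; rewrite /koszul; have VYZ := Vbr VY VZ'.
rewrite act_linl// !ip_linl// ip_linr// !ip_brr//.
by rewrite !(act_add, act_mul)//; ring.
Qed.

Lemma koszul_lin2 k X Y Y' Z : V X -> V Y -> V Y' -> V Z ->
  koszul X (k *: Y + Y') Z
    = k * koszul X Y Z + koszul X Y' Z + 2%:R * act X k * ip Y Z.
Proof.
move=> VX VY VY' VZ'; rewrite /koszul; have VXZ := Vbr VX VZ'.
rewrite act_linl// !ip_linl// !ip_linr// ip_brl// ip_brr//.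
by rewrite !(act_add, act_mul)// (ip_sym VX VY); ring.
Qed.

Lemma koszul_lin3 k X Y Z Z' : V X -> V Y -> V Z -> V Z' ->
  koszul X Y (k *: Z + Z') = k * koszul X Y Z + koszul X Y Z'.
Proof.
move=> VX VY VZ' VZ''; rewrite /koszul; have VXY := Vbr VX VY.
rewrite act_linl// !ip_linr// !ip_brl//.
by rewrite !(act_add, act_mul)// (ip_sym VX VZ') (ip_sym VY VZ'); ring.
Qed.

Definition is_connection (nabla : E -> E -> E) : Prop :=
  [/\ forall X Y, V X -> V Y -> V (nabla X Y),
      forall k X X' Y, V X -> V X' -> V Y ->
        nabla (k *: X + X') Y = k *: nabla X Y + nabla X' Y,
      forall X Y Y', V X -> V Y -> V Y' ->
        nabla X (Y + Y') = nabla X Y + nabla X Y' &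
      forall k X Y, V X -> V Y -> nabla X (k *: Y) = k *: nabla X Y + act X k
        *: Y].

Definition torsion_free (nabla : E -> E -> E) : Prop :=
  forall X Y, V X -> V Y -> nabla X Y - nabla Y X = br X Y.

Definition metric_on (W : set E) (nabla : E -> E -> E) : Prop :=
  forall X Y Z, W X -> W Y -> W Z ->
    act X (ip Y Z) = ip (nabla X Y) Z + ip Y (nabla X Z).

(** Substitute the metric identity for the three derivatives of inner products
and vanishing torsion for the three brackets: all terms but two cancel. *)
Lemma koszul_formula W nabla X Y Z : W `<=` V -> is_connection nabla ->
  torsion_free nabla -> metric_on W nabla -> W X -> W Y -> W Z ->
  2%:R * ip (nabla X Y) Z = koszul X Y Z.
Proof.
move=> WV [Vn _ _ _] tf met WX WY WZ; rewrite /koszul !met//.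
have VX := WV _ WX; have VY := WV _ WY; have VZ' := WV _ WZ.
have VXY := Vn _ _ VX VY; have VYX := Vn _ _ VY VX.
have VXZ := Vn _ _ VX VZ'; have VZX := Vn _ _ VZ' VX.
have VYZ := Vn _ _ VY VZ'; have VZY := Vn _ _ VZ' VY.
have NYX := VN VYX; have NZX := VN VZX; have NZY := VN VZY.
rewrite -!tf// !ipDl// !ipNl//.
rewrite (ip_sym VY (Vn _ _ VX VZ')) (ip_sym VX (Vn _ _ VY VZ')).
by rewrite (ip_sym VX (Vn _ _ VZ' VY)); ring.
Qed.

(** The Koszul formula is applied to the spanning fields only, hence the
metric identity on a subset [W] containing them is enough. *)
Theorem levi_civita_unique W nabla nabla' : W `<=` V -> (forall i, W (e i)) ->
  is_connection nabla -> torsion_free nabla -> metric_on W nabla ->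
  is_connection nabla' -> torsion_free nabla' -> metric_on W nabla' ->
  forall X Y, V X -> V Y -> nabla X Y = nabla' X Y.
Proof.
move=> WV We cn tn mn cn' tn' mn'.
have [Vn linX addY leib] := cn; have [Vn' linX' addY' leib'] := cn'.
have ee i j : nabla (e i) (e j) = nabla' (e i) (e j).
  apply/eqP; rewrite -subr_eq0; apply/eqP; have Vij := Vn _ _ (Ve i) (Ve j).
  have Vij' := Vn' _ _ (Ve i) (Ve j); have Nij' := VN Vij'.
  apply: nondegenerate => [|k]; first exact: VD.
  apply: (mulfI two_neq0); rewrite mulr0 ipDl// ipNl// mulrBr.
  by rewrite (koszul_formula WV cn)// (koszul_formula WV cn')// subrr.
have Xe X j : V X -> nabla X (e j) = nabla' X (e j).
  apply: (linear_on_spanned (F := nabla^~ (e j)) (G := nabla'^~ (e j))).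
  - by move=> k u v Vu Vv; exact: linX.
  - by move=> k u v Vu Vv; exact: linX'.
  - by move=> i; exact: ee.
(* The Leibniz terms cancel in the difference, which is linear in [Y]. *)
move=> X Y VX VY; apply/eqP; rewrite -subr_eq0; apply/eqP.
apply: (linear_on_spanned (F := fun Y => nabla X Y - nabla' X Y)
  (G := fun=> 0)) => //.
- move=> k u v Vu Vv; have Vku := VZ k Vu.
  have cancel (a b a' b' d : E) :
      a + d + b - (a' + d + b') = a - a' + (b - b').
    by rewrite (addrAC a) (addrAC a') opprD addrACA subrr addr0 opprD addrACA.
  by rewrite addY// addY'// leib// leib'// cancel scalerBr.
- by move=> k u v _ _; rewrite scaler0 addr0.
- by move=> i; rewrite Xe ?subrr.
Qed.

Lemma riesz_linear (phi : E -> K) :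
  (forall k u v, V u -> V v -> phi (k *: u + v) = k * phi u + phi v) ->
  exists v, V v /\ forall Z, V Z -> ip v Z = phi Z.
Proof.
move=> phiL; have [v [Vv vE]] := riesz (phi \o e); exists v; split=> //.
apply: (@linear_on_spanned K^o) => // k u w Vu Vw; exact: ip_linr.
Qed.

(** The Koszul expression is linear in its third argument, so nondegeneracy
represents it by a vector. *)
Theorem levi_civita_exists : exists nabla,
  [/\ is_connection nabla, torsion_free nabla & metric_on V nabla].
Proof.
have spec (XY : E * E) : exists v, V XY.1 -> V XY.2 -> V v /\
    forall Z, V Z -> 2%:R * ip v Z = koszul XY.1 XY.2 Z.
  have [[VX VY]|noV] := pselect (V XY.1 /\ V XY.2); last first.
    by exists 0 => VX VY; case: noV.
  have [|v [Vv vE]] := @riesz_linear (fun Z => 2%:R^-1 * koszul XY.1 XY.2 Z).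
    by move=> k u v Vu Vv; rewrite koszul_lin3//; ring.
  by exists v => _ _; split=> // Z VZ'; rewrite vE// mulVKf.
have [N NE] := choice spec.
pose nabla X Y := N (X, Y).
have Vn X Y : V X -> V Y -> V (nabla X Y) by move=> VX VY; case: (NE (X,
  Y) VX VY).
have nE X Y Z : V X -> V Y -> V Z -> 2%:R * ip (nabla X Y) Z = koszul X Y Z.
  by move=> VX VY VZ'; case: (NE (X, Y) VX VY) => _; apply.
have inj2 u v : V u -> V v ->
    (forall Z, V Z -> 2%:R * ip u Z = 2%:R * ip v Z) -> u = v.
  by move=> Vu Vv uv; apply: ip_inj => // Z /uv /(mulfI two_neq0).
exists nabla; split.
- split=> //.
  + move=> k X X' Y VX VX' VY; have VkX := Vlin k VX VX'.
    have VXY := Vn _ _ VX VY; have VX'Y := Vn _ _ VX' VY.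
    apply: inj2 => [||Z VZ']; [exact: Vn|exact: Vlin|].
    by rewrite nE// ip_linl// koszul_lin1// -!nE//; ring.
  + move=> X Y Y' VX VY VY'; have VYY' := VD VY VY'.
    have VXY := Vn _ _ VX VY; have VXY' := Vn _ _ VX VY'.
    apply: inj2 => [||Z VZ']; [exact: Vn|exact: VD|].
    rewrite nE// ipDl// -[Y in Y + Y']scale1r koszul_lin2// -!nE//.
    have act1 : act X 1 = 0.
      apply: (addIr (act X 1)); rewrite add0r -[in RHS](mulr1 1) act_mul//.
      by rewrite mulr1 mul1r.
    by rewrite act1; ring.
  + move=> k X Y VX VY; have VkY := VZ k VY; have VXY := Vn _ _ VX VY.
    have VaY := VZ (act X k) VY; have VkXY := VZ k VXY.
    apply: inj2 => [||Z VZ']; [exact: Vn|exact: VD|].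
    have kos0 : koszul X 0 Z = 0.
      have ip0 : ip 0 Z = 0 by rewrite -[0](scale0r Y) ipZl// mul0r.
      apply: (addIr (koszul X 0 Z)); have := koszul_lin2 1 VX V0 V0 VZ'.
      by rewrite scaler0 addr0 ip0 mulr0 addr0 mul1r add0r => <-.
    rewrite nE// ipDl// !ipZl// -[k *: Y]addr0 koszul_lin2// kos0 -nE//; ring.
- move=> X Y VX VY; have VXY := Vn _ _ VX VY; have VYX := Vn _ _ VY VX.
  have NYX := VN VYX; apply: inj2 => [||Z VZ']; [exact: VD|exact: Vbr|].
  rewrite ipDl// ipNl// mulrBr !nE// /koszul (br_anti VX VY) (ip_sym VY VX).
  by rewrite ipNl//; [ring|exact: Vbr].
- move=> X Y Z VX VY VZ'; apply: (mulfI two_neq0).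
  have VXY := Vn _ _ VX VY; have VXZ := Vn _ _ VX VZ'.
  rewrite mulrDr (ip_sym VY VXZ) !nE// /koszul (br_anti VY VZ') (ip_sym VZ' VY).
  by rewrite ipNl//; [ring|exact: Vbr].
Qed.

End LeviCivita.

(** * Nondegeneracy of the metric on algebroid vector fields *)

Section Gram.
Context {R : realType} {n : nat}.

Lemma psd_nondegenerate_definite (G : 'M[R]_n) :
  G^T = G -> (forall v : 'rV[R]_n, 0 <= (v *m G *m v^T) 0 0) ->
  (forall v : 'rV[R]_n,
    (forall w : 'rV[R]_n, (v *m G *m w^T) 0 0 = 0) -> v = 0) ->
  forall v : 'rV[R]_n, (v *m G *m v^T) 0 0 = 0 -> v = 0.
Proof.
move=> symG psd nondeg v v0; apply: nondeg => w.
have GC (x y : 'rV[R]_n) : (y *m G *m x^T) 0 0 = (x *m G *m y^T) 0 0.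
  have tr00 (A : 'M[R]_1) : A 0 0 = A^T 0 0 by rewrite mxE.
  by rewrite tr00 !trmx_mul trmxK symG mulmxA.
set b := (v *m G *m w^T) 0 0; set q := (w *m G *m w^T) 0 0.
have q0 : 0 <= q by exact: psd.
have addE (A B : 'M[R]_1) : (A + B) 0 0 = A 0 0 + B 0 0 by rewrite mxE.
have scaleE k (A : 'M[R]_1) : (k *: A) 0 0 = k * A 0 0 by rewrite mxE.
(* The quadratic form at [w + t v] is affine in [t]; choose [t] to make it
   negative unless [b = 0]. *)
have quad t : 0 <= q + 2 * t * b.
  have := psd (w + t *: v); rewrite linearD /= linearZ /= !mulmxDl !mulmxDr.
  rewrite -!scalemxAl -!scalemxAr !(addE, scaleE) (GC v) v0 -/b -/q.
  by move=> /le_trans; apply; rewrite le_eqVlt; apply/orP; left; apply/eqP;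
    ring.
apply/eqP/negPn/negP => b0.
have := quad (- (q + 1) / (2 * b)).
have -> : q + 2 * (- (q + 1) / (2 * b)) * b = -1 by field.
by rewrite lerNr oppr0 ler10.
Qed.

End Gram.

Section OffTheDivisors.
Context {R : realType}.

(** A neighbourhood of any point contains points off all the coordinate
hyperplanes of a normal crossing chart, so nonvanishing analytic functions
remain nonzero at some point where the metric is nondegenerate. *)
Lemma ODD_metric_nondegenerate_point n (M : manifold R n)
    (g : bilinear_field M) : ODD_metric g ->
  [/\ analytic_symmetric_form g, forall p, positive_semidefinite_at g p &
   forall (f : function M) p, analytic_function f -> f p != 0 ->
     exists q, f q != 0 /\ nondegenerate_at g q].
Proof.
case=> {}n {}M {}g m d N phi sym_g psd lt_dn _ nondeg _ snc;
  split=> // f p af fp.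
have [c [pc cN]] := snc p.
have fc := analytic_at_continuous (analytic_function_at af pc).
have f_near : \forall x \near c p, f (chart_inv c x) != 0.
  have : (f \o chart_inv c) (c p) != 0 by rewrite /= (chart_invK pc).
  move=> f0.
  have near0 : nbhs ((f \o chart_inv c) (c p)) [set y : R | y != 0].
    exact: open_nbhs_nbhs.
  exact: (fc _ near0).
have /= nearP := filterI f_near (near_charts_at pc pc).
have [t /= t0 ball_t] := (nbhs_ballP (c p) _).1 (nearP (nbhs_filter _)).
(* Move every coordinate of [c p] away from zero. *)
pose x : 'rV[R]_n := \row_i (c p 0 i + (if 0 <= c p 0 i then t / 2 else - (t /
  2))).
have t2 : 0 < t / 2 by rewrite divr_gt0.
have xball : ball (c p) t x.
  rewrite -ball_normE /= distrC; apply: polydisc_norm_lt => // i.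
  rewrite !mxE addrAC subrr add0r.
  by case: ifP => _; rewrite ?normrN gtr0_norm// ltr_pdivrMr// mulr_natr mulr2n
    ltrDl.
have x_neq0 i : x 0 i != 0.
  rewrite mxE; case: ifP => [ge0|/negbT]; first by rewrite gt_eqF// ltr_wpDl.
  by rewrite -ltNge => lt0; rewrite lt_eqF// subr_lt0 (lt_trans lt0).
have [fq [qc [_ cq]]] := ball_t _ xball.
exists (chart_inv c x); split=> //; apply: nondeg => j range_j.
have [noN|[S [cardS SE]]] := cN j.
  have : (range (phi j) `&` chart_dom c) (chart_inv c x) by split=> //;
    case: qc.
  by rewrite noN.
have /set0Pn[i iS] : S != finset.set0.
  apply: contraTneq (lt_dn j) => S0; rewrite -cardS S0 cards0 add0n.
  by rewrite ltnn.
have [_ cqd] := qc; have /(_ range_j i iS) := (SE _ cqd).1.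
by rewrite cq => /eqP; exact/negP.
Qed.

End OffTheDivisors.

Section GramMatrix.
Context {R : realType} {n : nat} (M : manifold R n).
Context (K : closedFieldType) (iota : function M -> K).
Hypothesis alg : algebroid_functions iota.
Variable g : bilinear_field M.
Hypothesis odd_g : ODD_metric g.

Lemma analytic_metric_pairing X Y : analytic_symmetric_form g ->
  analytic_vector_field X -> analytic_vector_field Y ->
  analytic_function (metric_pairing g X Y).
Proof.
move=> sym_g aX aY; rewrite metric_pairing_flat.
by apply: analytic_pairing => //; exact: analytic_flat.
Qed.

(** At a point where the fields [e i] are linearly independent and [g] is
positive definite, their Gram matrix is invertible. *)
Lemma gram_det_neq0 r (e : 'I_r -> vector_field M)
    (theta : 'I_r -> one_form M) : independent_fields iota e theta ->
  \det (\matrix_(i, j) iota (metric_pairing g (e i) (e j))) != 0.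
Proof.
move=> [aE aT D0]; have [sym_g psd dense] :=
  ODD_metric_nondegenerate_point odd_g.
have aP i j : analytic_function (pairing (theta j) (e i)) by exact:
  analytic_pairing.
have /(det_iota_neq0 alg aP)[p Dp] := D0.
have [aD _] := analytic_function_det alg aP.
have [q [Dq nondeg]] := dense _ p aD Dp.
apply/(det_iota_neq0 alg (F := fun i j => metric_pairing g (e i) (e j))).
  by move=> i j; exact: analytic_metric_pairing.
exists q; have qc := charts_at_chart_at q.
have freeA := field_matrix_row_free aE aT qc Dq.
set A := field_matrix e q (chart_at q) in freeA.
set G := g q (chart_at q).
have [_ symG _] := sym_g.
have HE : \matrix_(i, j) metric_pairing g (e i) (e j) q = A *m G *m A^T.
  apply/matrixP => i j; rewrite mxE /metric_pairing -/G mxE [RHS]mxE.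
  apply: eq_bigr => k _; rewrite mxE [in RHS]mxE [X in _ * X]mxE.
  rewrite [X in _ = _ * X]mxE [X in _ = _ * X]mxE; congr (_ * _).
  by apply: eq_bigr => l _; rewrite [X in _ = X * _]mxE.
rewrite HE -unitfE -unitmxE -row_free_unit; apply: inj_row_free => v vH.
have vA : v *m A = 0.
  apply: (psd_nondegenerate_definite (symG _ _ qc) (psd q _ qc) (nondeg _ qc)).
  have vH' : v *m A *m G *m A^T = 0 by rewrite -[RHS]vH !mulmxA.
  by rewrite trmx_mul mulmxA vH' mul0mx mxE.
by apply: (row_free_inj freeA); rewrite mul0mx.
Qed.

End GramMatrix.

(** * Existence and uniqueness of the connection *)

Theorem theorem4p2 (R : realType) (n : nat) (M : manifold R n)
    (g : bilinear_field M) (K : closedFieldType) (iota : function M -> K) :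
  connected [set: M] ->
  ODD_metric g ->
  algebroid_functions iota ->
  exists nabla : Kfield M K -> Kfield M K -> Kfield M K,
    [/\ algebroid_connection iota nabla,
        ODD_metric_connection iota g nabla,
        symmetric_connection iota nabla &
        forall nabla' : Kfield M K -> Kfield M K -> Kfield M K,
          algebroid_connection iota nabla' ->
          ODD_metric_connection iota g nabla' ->
          symmetric_connection iota nabla' ->
          forall X Y, algebroid_vf iota X -> algebroid_vf iota Y ->
            nabla' X Y = nabla X Y].
Proof.
move=> _ odd_g alg; have [sym_g _ _] := ODD_metric_nondegenerate_point odd_g.
have [r [e [theta [ind spanE]]]] := algebroid_vf_spanned alg.
have [aE _ _] := ind; have gram0 := gram_det_neq0 alg odd_g ind.
set H := \matrix_(i, j) _ in gram0;
  have uH : H \in unitmx by rewrite unitmxE unitfE.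
pose V := algebroid_vf iota; pose W := meromorphic_vf iota.
pose E i := of_vector_field iota (e i).
have VE i : V (E i) by exact: algebroid_of_vector_field.
have WV : W `<=` V by move=> v [m [a [X [_ vE]]]]; exists m, a, X.
have WE i : W (E i).
  exists 1%N, (fun=> 1), (fun=> e i); split; last exact: represents1.
  by move=> _; rewrite -(iota1 alg); apply: meromorphic_iota => //;
    exact: analytic_function_cst.
have ip_basis (a : 'I_r -> K) j :
    inner iota g (combination iota a e) (E j) = ((\row_i a i) *m H) 0 j.
  have aR : represents iota (combination iota a e) a e by [].
  rewrite (innerE sym_g aR (represents1 iota (aE j))) /inner_value mxE.
  by apply: eq_bigr => i _; rewrite big_ord1 mulr1 !mxE.
have spanned v : V v -> exists a : 'I_r -> K, v = \sum_i a i *: E i.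
  by move=> /spanE[a ->]; exists a.
have nondeg v : V v -> (forall i, inner iota g v (E i) = 0) -> v = 0.
  move=> /spanE[a ->] v0.
  have a0 : \row_i a i = 0.
    apply: (can_inj (mulmxK uH)); rewrite mul0mx; apply/rowP => j.
    by rewrite -ip_basis v0 mxE.
  rewrite /combination big1// => i _; have /rowP/(_ i) := a0.
  by rewrite !mxE => ->; rewrite scale0r.
have riesz (phi : 'I_r -> K) : exists v, V v /\ forall i,
  inner iota g v (E i) = phi i.
  pose a i := ((\row_j phi j) *m invmx H) 0 i.
  exists (combination iota a e); split; first by exists r, a, e.
  move=> i; rewrite ip_basis; have -> : \row_i a i = (\row_j phi j) *m invmx H.
    by apply/rowP => j; rewrite mxE.
  by rewrite mulmxKV// mxE.
have two0 : 2%:R != 0 :> K by rewrite (natr_K_eq0 alg).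
have V0 : V 0 by exact: algebroid_vf0.
have Vlin := algebroid_vf_linear alg.
have actL := act_linear alg.
have actA u x y (Vu : V u) := actD alg x y Vu.
have actP u x y (Vu : V u) := actM alg x y Vu.
have ipL k u v w (Vu : V u) (Vv : V v) (Vw : V w) :=
  inner_linearl alg sym_g k Vu Vv Vw.
have ipC u v (Vu : V u) (Vv : V v) := innerC sym_g Vu Vv.
have Vbr := algebroid_bracket alg.
have brC := bracketC alg.
have brD := bracketDr alg.
have brZ k u v (Vu : V u) (Vv : V v) := bracketZr alg k Vu Vv.
have VZ k Y : V Y -> V (k *: Y) by exact: algebroid_vfZ.
have conn nabla : algebroid_connection iota nabla <->
    is_connection V (act iota) nabla.
  split=> [[closed linX linY leib]|[closed linX addY leib]]; split=> //.
  - move=> X Y Y' VX VY VY'; have := linY 1 X Y Y' VX VY VY'.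
    by rewrite (iota1 alg) !scale1r.
  - move=> k X Y Y' VX VY VY'; rewrite addY//; last exact: VZ.
    by rewrite leib// (act_cst alg)// scale0r addr0.
have sym nabla : symmetric_connection iota nabla <->
    torsion_free V (bracket iota) nabla.
  split=> tf X Y VX VY; have := tf X Y VX VY.
    by rewrite /torsion => /eqP; rewrite subr_eq0 => /eqP.
  by rewrite /torsion => ->; rewrite subrr.
have [nabla [cn tn mn]] := levi_civita_exists two0 V0 Vlin actL actA actP ipL
  ipC
  Vbr brC brD brZ VE spanned nondeg riesz.
have mnW : metric_on (act iota) (inner iota g) W nabla.
  by move=> X Y Z WX WY WZ; apply: mn; exact: WV.
exists nabla; split; [exact/conn|exact: mnW|exact/sym|].
move=> nabla' /conn cn' mn' /sym tn' X Y VX VY.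
exact: (levi_civita_unique two0 V0 Vlin ipL ipC VE spanned nondeg WV WE
  cn' tn' mn' cn tn mnW VX VY).
Qed.
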